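(* Let $\Omega\subseteq\mathbb R^N$ be a (Lebesgue) measurable set with $\mu(\Omega)=\infty$, let $1\le p\le\infty$, let $J_0:\mathbb R^N\to\mathbb R$, and let $K_Ju(x)=\int_\Omega J_0(x-y)u(y)\,dy$ for $x\in\Omega$. Let $1\le q,r\le\infty$. (i) If $J_0\in L^r(\mathbb R^N)$ and $\frac1q=\frac1p+\frac1r-1$, then $K_J\in\mathcal L(L^p(\Omega),L^q(\Omega))$ and $$\|K_J\|_{\mathcal L(L^p(\Omega),L^q(\Omega))}\le\|J_0\|_{L^r(\mathbb R^N)}.$$ In particular, if $r=1$ we can take $p=q$. (ii) If $\Omega\subset\mathbb R^N$ is open, $J_0\in W^{1,r}(\mathbb R^N)$ and $\frac1q=\frac1p+\frac1r-1$, then $K_J\in\mathcal L(L^p(\Omega),W^{1,q}(\Omega))$ and $$\|K_J\|_{\mathcal L(L^p(\Omega),W^{1,q}(\Omega))}\le\|J_0\|_{W^{1,r}(\mathbb R^N)}.$$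
   Context: $\mu$ is Lebesgue measure on $\mathbb R^N$. The kernel is $J(x,y)=J_0(x-y)$ for $x,y\in\Omega$. $\mathcal L(X,Y)$ is the space of bounded linear operators from $X$ to $Y$. *)

(* Defs.v *)
From HB Require Import structures.
From mathcomp Require Import all_boot all_order all_algebra.
From mathcomp Require Import all_classical all_reals all_analysis.

Set Implicit Arguments.
Unset Strict Implicit.
Unset Printing Implicit Defensive.

Import Order.TTheory GRing.Theory Num.Theory.
Import numFieldNormedType.Exports.

Local Open Scope classical_set_scope.
Local Open Scope ring_scope.

(* Throughout, R^N (N >= 1) is 'rV[R]_n.+1 with N = n.+1. *)

Section lebesgue_outer_measure.
Context {R : realType} {n : nat}.
Implicit Types (a b : 'rV[R]_n.+1) (A : set 'rV[R]_n.+1).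
Local Open Scope ereal_scope.

Definition box a b : set 'rV[R]_n.+1 :=
  [set x | forall i, (a ord0 i < x ord0 i <= b ord0 i)%R].

Definition box_volume a b : \bar R :=
  (\prod_i Num.max 0 (b ord0 i - a ord0 i))%R%:E.

Definition box_cover A : set ('rV[R]_n.+1 * 'rV[R]_n.+1)^nat :=
  [set c | A `<=` \bigcup_k box (c k).1 (c k).2].

Definition lebesgue_outer A : \bar R :=
  ereal_inf [set \sum_(k <oo) box_volume (c k).1 (c k).2 | c in box_cover A].

Lemma box_volume_ge0 a b : 0 <= box_volume a b.
Proof. by rewrite lee_fin prodr_ge0// => i _; rewrite le_max lexx. Qed.

Lemma box_volume0 : box_volume 0 0 = 0.
Proof.
by rewrite /box_volume big_ord_recl subrr maxxx mul0r.
Qed.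

Lemma lebesgue_outer_ge0 A : 0 <= lebesgue_outer A.
Proof.
by apply: le_ereal_inf_tmp => _ [c _ <-]; apply: nneseries_ge0 => k _ _;
  exact: box_volume_ge0.
Qed.

Lemma lebesgue_outer0 : lebesgue_outer set0 = 0.
Proof.
apply/eqP; rewrite eq_le lebesgue_outer_ge0 andbT.
apply: ereal_inf_lbound; exists (fun=> (0%R, 0%R)) => //=.
by apply: eseries0 => k _ _; exact: box_volume0.
Qed.

Lemma le_lebesgue_outer :
  {homo lebesgue_outer : A B / A `<=` B >-> A <= B}.
Proof.
move=> A B AB; apply: ereal_inf_le_tmp => _ [c Bc <-].
by exists c => //; exact: subset_trans Bc.
Qed.

Lemma lebesgue_outer_sigma_subadditive : sigma_subadditive lebesgue_outer.
Proof.
move=> A; have [[i ioo]|] := pselect (exists i, lebesgue_outer (A i) = +oo).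
  rewrite (eseries_pinfty _ _ ioo) ?leey// => k _.
  by rewrite -ltNye (lt_le_trans _ (lebesgue_outer_ge0 _)).
rewrite -forallNE => Aoo.
suff add2e (e : {posnum R}) : lebesgue_outer (\bigcup_k A k) <=
    \sum_(i <oo) lebesgue_outer (A i) + e%:num%:E.
  by apply/lee_addgt0Pr => _/posnumP[].
rewrite (le_trans _ (epsilon_trick _ _ _))//; last first.
  by move=> k; exact: lebesgue_outer_ge0.
have [G PG] : {G : nat -> ('rV[R]_n.+1 * 'rV[R]_n.+1)^nat & forall k,
    box_cover (A k) (G k) /\ \sum_(j <oo) box_volume (G k j).1 (G k j).2 <=
      lebesgue_outer (A k) + (e%:num / (2 ^ k.+1)%:R)%:E}.
  apply: (@choice _ _ (fun k c => box_cover (A k) c /\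
      \sum_(j <oo) box_volume (c j).1 (c j).2 <=
      lebesgue_outer (A k) + (e%:num / (2 ^ k.+1)%:R)%:E)) => k.
  have en1 : (0 < e%:num / (2 ^ k.+1)%:R)%R by [].
  have Afin : lebesgue_outer (A k) \is a fin_num.
    by rewrite ge0_fin_numE ?lebesgue_outer_ge0// ltey; exact/eqP/Aoo.
  have [_ [c Ac <-] cA] := lb_ereal_inf_adherent en1 Afin.
  by exists c; split => //; exact: ltW cA.
pose F (x : nat * nat) := box_volume (G x.1 x.2).1 (G x.1 x.2).2.
have F_ge0 x : 0 <= F x by exact: box_volume_ge0.
apply: (@le_trans _ _ (\esum_(x in setT) F x)).
  have /card_esym/ppcard_eqP[f] := card_nat2.
  apply: ereal_inf_lbound => /=; exists (fun k => G (f k).1 (f k).2).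
    move=> t [i _ Ait]; have [j _ Gt] := (PG i).1 _ Ait.
    by exists (f^-1%FUN (i, j)) => //=; rewrite invK ?inE.
  rewrite -(esum_pred_image F f xpredT) ?[fun=> _]set_true//.
  by rewrite image_eq.
rewrite (_ : esum _ _ = \sum_(i <oo) \sum_(j <oo) F (i, j)); last first.
  pose J : nat -> set (nat * nat) := fun i => [set (i, j) | j in setT].
  rewrite (_ : setT = \bigcup_k J k); last first.
    by rewrite predeqE => -[a b]; split => // _; exists a => //; exists b.
  rewrite esum_bigcupT//=; last first.
    apply/trivIsetP => i j _ _ ij.
    rewrite predeqE => -[k m] /=; split => //= -[] [_] _ [<-{k} _].
    by move=> [m' _] [] /esym/eqP; rewrite (negbTE ij).
  rewrite -(image_id [set: nat]) -fun_true esum_pred_image//; last first.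
    by move=> k _; exact: esum_ge0.
  apply: eq_eseriesr => /= j _.
  rewrite -(esum_pred_image F (pair j) predT)//=; last first.
    by move=> ? ? _ _; exact: (@can_inj _ _ _ snd).
  by congr esum; rewrite predeqE => -[a b]; split; move=> [i _ <-]; exists i.
apply: lee_nneseries => k _; first by move=> _; exact: nneseries_ge0.
exact: (PG k).2.
Qed.

HB.instance Definition _ := isOuterMeasure.Build R _ lebesgue_outer
  lebesgue_outer0 lebesgue_outer_ge0 le_lebesgue_outer
  lebesgue_outer_sigma_subadditive.

End lebesgue_outer_measure.

(* The measurable subsets of R^N are the Lebesgue measurable ones, i.e. the
   Caratheodory measurable sets of the Lebesgue outer measure. *)
HB.instance Definition _ (R : realType) (n : nat) :=
  @isMeasurable.Build (caratheodory_display (@lebesgue_outer R n))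
    'rV[R]_n.+1 (@lebesgue_outer R n).-caratheodory
    (caratheodory_measurable_set0 _)
    (@caratheodory_measurable_setC _ _ _)
    (@caratheodory_measurable_bigcup _ _ _).

Definition lebesgue_rV (R : realType) (n : nat) : set 'rV[R]_n.+1 -> \bar R :=
  @lebesgue_outer R n.

HB.instance Definition _ (R : realType) (n : nat) :=
  isMeasure.Build _ 'rV[R]_n.+1 R (@lebesgue_rV R n)
    (@caratheodory_measure0 _ _ (@lebesgue_outer R n))
    (@caratheodory_measure_ge0 _ _ (@lebesgue_outer R n))
    (@caratheodory_measure_sigma_additive _ _ (@lebesgue_outer R n)).

Section function_spaces.
Context {R : realType} {n : nat}.
Local Notation V := 'rV[R]_n.+1.
Local Notation leb := (@lebesgue_rV R n).
Implicit Types (Omega : set V) (p : \bar R) (u g : V -> R).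

(* A space of functions on a subset Omega of R^N, with its norm. Its elements
   are represented by functions on R^N whose values outside Omega are
   irrelevant; classes modulo equality almost everywhere on Omega are handled
   in [bounded_linear] below. *)
Record fun_space := FunSpace {
  fun_space_set :> (V -> R) -> Prop ;
  fun_norm : (V -> R) -> \bar R }.

(* [u \_ Omega] is u extended by 0 outside Omega. *)
Definition Lp p Omega : fun_space := {|
  fun_space_set := fun u => u \_ Omega \in Lfun leb p ;
  fun_norm := fun u => 'N[leb]_p[EFin \o (u \_ Omega)]%E |}.

Definition partial (i : 'I_n.+1) (f : V -> R) : V -> R :=
  'D_(delta_mx ord0 i) f.

Definition Cinfty (f : V -> R) := forall s : seq 'I_n.+1,
  continuous (foldr partial f s) /\
  forall i x, derivable (foldr partial f s) x (delta_mx ord0 i).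

Definition test_function Omega (f : V -> R) :=
  [/\ Cinfty f, compact (closure [set x | f x != 0]) &
      closure [set x | f x != 0] `<=` Omega].

Definition weak_partial Omega (i : 'I_n.+1) u g :=
  forall phi, test_function Omega phi ->
  \int[leb]_(x in Omega) (u x * partial i phi x) =
  - \int[leb]_(x in Omega) (g x * phi x).

Definition weak_gradient p Omega u (G : 'I_n.+1 -> V -> R) :=
  forall i, Lp p Omega (G i) /\ weak_partial Omega i u (G i).

(* The norm is the sum of the L^p norms of u and of its weak first order
   partial derivatives. For u in W^{1,p} the weak gradient is unique up to
   equality almost everywhere, so the infimum is over a single value. *)
Definition W1 p Omega : fun_space := {|
  fun_space_set :=
    fun u => Lp p Omega u /\ exists G, weak_gradient p Omega u G ;
  fun_norm := fun u => ereal_inf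
    [set (fun_norm (Lp p Omega) u + \sum_i fun_norm (Lp p Omega) (G i))%E
      | G in weak_gradient p Omega u] |}.

(* K induces a bounded linear operator X -> Y between spaces of classes of
   functions on Omega. *)
Definition bounded_linear Omega (X Y : fun_space)
    (K : (V -> R) -> (V -> R)) :=
  [/\ forall u, X u -> Y (K u),
      forall u v, X u -> X v ->
        u = v %[ae leb in Omega] -> K u = K v %[ae leb in Omega],
      forall (a : R) u v, X u -> X v ->
        K (a \*: u \+ v) = a \*: K u \+ K v %[ae leb in Omega] &
      exists C : R, forall u, X u ->
        (fun_norm Y (K u) <= C%:E * fun_norm X u)%E].

Definition operator_norm (X Y : fun_space) (K : (V -> R) -> (V -> R)) :
    \bar R :=
  ereal_sup [set fun_norm Y (K u) | u in [set u | X u /\ (fun_norm X u <= 1)%E]].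

Definition kernel_operator Omega (J0 u : V -> R) (x : V) : R :=
  \int[leb]_(y in Omega) (J0 (x - y) * u y).

(* The integral defining K_J u converges at almost every point of Omega, so
   that [kernel_operator], which uses the value 0 at points where the Lebesgue
   integral is not finite, is the intended operator. *)
Definition kernel_operator_defined Omega (J0 : V -> R) (X : fun_space) :=
  forall u, X u -> {ae leb, forall x, Omega x ->
    leb.-integrable Omega (fun y => (J0 (x - y) * u y)%:E)}.

End function_spaces.

Arguments fun_space : clear implicits.

(* Main.v *)
Require Import Defs.
From HB Require Import structures.
From mathcomp Require Import all_boot all_order all_algebra.
From mathcomp Require Import all_classical all_reals all_analysis.
From mathcomp Require Import measurable_realfun ess_sup_inf ring lra.

Set Implicit Arguments.
Unset Strict Implicit.
Unset Printing Implicit Defensive.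

Import Order.TTheory GRing.Theory Num.Theory.
Import numFieldNormedType.Exports.

Local Open Scope classical_set_scope.
Local Open Scope ereal_scope.

(** Extend u by 0 outside Omega: then K u is the restriction to Omega of the
convolution of J0 with u.  Part (i) is Young's inequality for convolutions.
Part (ii) is the same inequality applied to J0 and to its weak partial
derivatives G i, once the functions K_(G i) u are known to be weak partial
derivatives of K u.

Young's inequality is proved for a kernel K(x, y) on a product of two
sigma-finite spaces, all of whose sections in x and in y have L^r norm at most
A ([kernel_young]).  After normalising K and g, a Hoelder inequality with three
exponents ([hoelder3_normalized]) yields, for every x,
(int K(x, y) g(y) dy)^q <= int K(x, y)^r g(y)^p dy, and integrating in x with
Tonelli's theorem bounds the L^q norm by 1.  The three-exponent inequality is
the integral of the weighted arithmetic-geometric mean inequality.  When q is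
infinite, the estimate is the usual Hoelder inequality for each x.

Two properties of Lebesgue measure turn this into a statement on J0(x - y).
One is invariance under the reflections x |-> v - x, hence under translations:
a reflection maps a half-open box to a box up to some faces, which an enlarged
box of almost the same volume absorbs ([lebesgue_outer_reflection]).  The other
is joint measurability.  For a Lebesgue measurable J0 the map
(x, y) |-> J0(x - y) may fail to be measurable for the product of the two
Lebesgue sigma-algebras, but J0 agrees almost everywhere with a J for which it
is ([diff_measurable_version]), and changing J0 on a null set changes none of
the integrals.

For the weak derivatives, Fubini's theorem and translation invariance give,
for a test function phi on Omega,
int_Omega (K u) d_i phi = int u(y) (int J0(z) (d_i phi)(z + y) dz) dy
([kernel_operator_pairing]).  For each y, phi(. + y) is a test function on the
whole space, so the inner integral is - int (G i)(z) phi(z + y) dz, and the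
same identity read backwards for G i gives - int_Omega (K_(G i) u) phi.  Each
weak gradient of J0 thus provides one of K u, which bounds the infimum that
defines the norm of K u in W^{1,q}. *)

(** * Reflections and boxes for the Lebesgue outer measure *)

Section lebesgue_outer_invariance.
Context {R : realType} {n : nat}.
Local Notation V := 'rV[R]_n.+1.
Local Notation outer := (@lebesgue_outer R n).

(** The preimages of the boxes of a cover of A lie in boxes that cover the
preimage of A; the k-th one is allowed a surplus e / 2^(k+1), so that the total
surplus is at most e. *)
Lemma lebesgue_outer_preimage (f : V -> V) :
  (forall a b (e : R), (0 < e)%R -> exists a' b' : V,
      f @^-1` box a b `<=` box a' b' /\
      box_volume a' b' <= box_volume a b + e%:E) ->
  forall A : set V, outer (f @^-1` A) <= outer A.
Proof.
move=> fbox A; apply: le_ereal_inf_tmp => _ [c Ac <-].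
apply/lee_addgt0Pr => e e0.
have /choice [d dP] : forall k, exists d : V * V,
    f @^-1` box (c k).1 (c k).2 `<=` box d.1 d.2 /\
    box_volume d.1 d.2 <=
      box_volume (c k).1 (c k).2 + (e / (2 ^ k.+1)%:R)%:E.
  move=> k; have ek : (0 < e / (2 ^ k.+1)%:R)%R.
    by rewrite divr_gt0// ltr0n expn_gt0.
  by have [a' [b' ab']] := fbox (c k).1 (c k).2 _ ek; exists (a', b').
apply: (@le_trans _ _ (\sum_(k <oo) box_volume (d k).1 (d k).2)).
  apply: ereal_inf_lbound; exists d => // x /Ac[k _ fx].
  by exists k => //; exact: (dP k).1.
apply: (le_trans _ (epsilon_trick xpredT _ (ltW e0))).
  by apply: lee_nneseries => k _; [move=> _; exact: box_volume_ge0|exact: (dP k).2].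
by move=> k; exact: box_volume_ge0.
Qed.

(** The volume is a continuous function of d, being a finite product. *)
Lemma box_volume_enlarge (a b : V) (e : R) : (0 < e)%R -> exists2 d : R,
  (0 < d)%R & box_volume a (b + const_mx d) <= box_volume a b + e%:E.
Proof.
move=> e0.
pose F (d : R) := (\prod_i Num.max 0 (b ord0 i - a ord0 i + d))%R.
have cF : continuous F.
  move=> d; apply: (@cvg_big R _ *%R 1%R xpredT mul_continuous R _ _
    (fun (i : 'I_n.+1) d => Num.max 0 (b ord0 i - a ord0 i + d))%R
    (fun (i : 'I_n.+1) => Num.max 0 (b ord0 i - a ord0 i + d))%R) => i _.
  apply: (@continuous_max R R (fun=> 0%R)
    (fun d => b ord0 i - a ord0 i + d)%R); first exact: cvg_cst.
  by apply: cvgD; [exact: cvg_cst|exact: cvg_id].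
have /cvgrPdist_lt /(_ _ e0) := cF 0%R.
move=> /nbhs_ballP[d /= d0 dF].
have d2 : (0 < d / 2)%R by rewrite divr_gt0.
exists (d / 2)%R => //.
have /dF : ball (0 : R)%R d (d / 2)%R.
  by rewrite /ball/= sub0r normrN gtr0_norm//; lra.
move=> /=; rewrite distrC => /ltr_normlW; rewrite ltrBlDl => Fd.
rewrite /box_volume -EFinD lee_fin.
have -> : (\prod_i Num.max 0 ((b + const_mx (d / 2)) ord0 i - a ord0 i) =
           F (d / 2))%R.
  by apply: eq_bigr => i _; rewrite !mxE addrAC.
rewrite (_ : \prod_i _ = F 0)%R ?(ltW Fd)//.
by apply: eq_bigr => i _; rewrite addr0.
Qed.

(** A reflection is an involution, so one inequality suffices.  Translations
inherit the property, each being a product of two reflections. *)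
Lemma lebesgue_outer_reflection (v : V) (A : set V) :
  outer [set x | A (v - x)%R] = outer A.
Proof.
suff le (B : set V) : outer [set x | B (v - x)%R] <= outer B.
  apply/eqP; rewrite eq_le le/=.
  rewrite -[leLHS](_ : outer [set x | A (v - (v - x))%R] = _); first exact: le.
  by congr outer; apply/funext => x /=; rewrite subKr.
apply: lebesgue_outer_preimage => a b e e0.
have [d d0 vol] := box_volume_enlarge (v - b)%R (v - a)%R e0.
(* The preimage of box a b contains its lower faces, which the box from v - b
   to v - a leaves out; the lower corner is therefore moved by d. *)
exists (v - b - const_mx d)%R, (v - a)%R; split.
  move=> x xab i; have := xab i; rewrite !mxE => /andP[ax xb].
  by apply/andP; split; lra.
rewrite (_ : box_volume (v - b - const_mx d)%R (v - a)%R =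
             box_volume (v - b)%R (v - a + const_mx d)%R); last first.
  by congr EFin; apply: eq_bigr => i _; rewrite !mxE; congr Num.max; lra.
rewrite (le_trans vol)// leeD2r// lee_fin le_eqVlt; apply/orP; left; apply/eqP.
by apply: eq_bigr => i _; rewrite !mxE; congr Num.max; lra.
Qed.

End lebesgue_outer_invariance.

Section measurable_boxes.
Context {R : realType} {n : nat}.
Local Notation V := 'rV[R]_n.+1.
Local Notation outer := (@lebesgue_outer R n).
Local Notation leb := (@lebesgue_rV R n).

Lemma box_volume_split (a b : V) (i : 'I_n.+1) (c : R) :
  box_volume a (\row_j if j == i then Num.min (b ord0 j) c else b ord0 j)%R +
  box_volume (\row_j if j == i then Num.max (a ord0 j) c else a ord0 j)%R b =
  box_volume a b.
Proof.
rewrite /box_volume -EFinD; congr EFin.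
rewrite (bigD1 i)//= [X in (_ + X)%R](bigD1 i)//= [RHS](bigD1 i)//= !mxE eqxx.
under eq_bigr => j ji do rewrite !mxE (negbTE ji).
under [X in (_ + _ * X)%R]eq_bigr => j ji do rewrite !mxE (negbTE ji).
rewrite -mulrDl; congr (_ * _)%R.
have [bc|bc] := leP (b ord0 i) c; have [ac|ac] := leP (a ord0 i) c;
 rewrite /Num.max; repeat case: ifPn; rewrite -?leNgt; lra.
Qed.

(** Cutting each box of a cover along the hyperplane x_i = c gives covers of the
two parts of X, and [box_volume_split] says that no volume is lost. *)
Lemma measurable_halfspace (i : 'I_n.+1) (c : R) :
  measurable [set x : V | (x ord0 i <= c)%R].
Proof.
apply: le_caratheodory_measurable => X.
apply: le_ereal_inf_tmp => _ [d Xd <-].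
pose bl k := (\row_j if j == i then Num.min ((d k).2 ord0 j) c
  else (d k).2 ord0 j)%R : V.
pose ar k := (\row_j if j == i then Num.max ((d k).1 ord0 j) c
  else (d k).1 ord0 j)%R : V.
rewrite (_ : limn _ = \sum_(k <oo) box_volume (d k).1 (bl k) +
                      \sum_(k <oo) box_volume (ar k) (d k).2); last first.
  rewrite -nneseriesD; last 2 first.
    by move=> *; exact: box_volume_ge0.
    by move=> *; exact: box_volume_ge0.
  by apply: eq_eseriesr => k _; rewrite box_volume_split.
apply: leeD; apply: ereal_inf_lbound.
- exists (fun k => ((d k).1, bl k)) => // x [/Xd[k _ dx] xc]; exists k => // j.
  rewrite mxE; have /andP[-> xb] /= := dx j; case: ifPn => // /eqP ->.
  by rewrite le_min xc andbT; have /andP[] := dx i.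
- exists (fun k => (ar k, (d k).2)) => // x [/Xd[k _ dx] /negP].
  rewrite -ltNge => xc; exists k => // j.
  rewrite mxE; have /andP[ax ->] := dx j; case: ifPn => [/eqP ->|]; rewrite ?ax//.
  by rewrite gt_max xc !andbT; have /andP[] := dx i.
Qed.

Lemma boxE (a b : V) : box a b =
  \bigcap_(i in [set: 'I_n.+1]) ([set x : V | (x ord0 i <= b ord0 i)%R] `\`
                                [set x : V | (x ord0 i <= a ord0 i)%R]).
Proof.
apply/seteqP; split => x.
  by move=> abx i _ /=; have /andP[ax ->] := abx i; split=> //; apply/negP; rewrite -ltNge.
by move=> abx i; have [/= -> /negP] := abx i I; rewrite -ltNge => ->.
Qed.

Lemma measurable_box (a b : V) : measurable (box a b).
Proof.
rewrite boxE; apply: fin_bigcap_measurable => // i _.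
by apply: measurableD; exact: measurable_halfspace.
Qed.

Lemma lebesgue_rV_box_lty (a b : V) : leb (box a b) < +oo.
Proof.
apply: (@le_lt_trans _ _ (box_volume a b)); last exact: ltry.
apply: ereal_inf_lbound.
exists (fun k => if k == 0%N then (a, b) else (0, 0)%R) => /=.
  by move=> x abx; exists 0%N.
rewrite (nneseriesD1 (n := 0%N))//=; last by move=> k _; exact: box_volume_ge0.
by rewrite eseries0 ?adde0// => -[|k]//= _ _; exact: box_volume0.
Qed.

(** These cubes exhaust the space; they serve both as the sets of finite measure
in sigma-finiteness and as bounds for compact supports. *)
Definition cube (k : nat) : set V :=
  box (const_mx (- k%:R)%R) (const_mx k%:R%R).

Lemma cubeP (k : nat) (x : V) : (`|x| < k%:R)%R -> cube k x.
Proof.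
move=> xk i; rewrite !mxE.
have : (`|x ord0 i| < k%:R)%R.
  apply: le_lt_trans xk; rewrite [leRHS]mx_normrE.
  exact: (@le_bigmax _ _ _ 0%R (fun ij : 'I_1 * 'I_n.+1 => `|x ij.1 ij.2|)%R (ord0, i)).
by rewrite ltr_norml => /andP[-> /ltW].
Qed.

Lemma bigcup_cube : \bigcup_k cube k = setT.
Proof.
apply/seteqP; split => // x _.
by exists (Num.truncn `|x|%R).+1 => //; apply: cubeP; exact: truncnS_gt.
Qed.

Lemma lebesgue_rV_sigma_finite : sigma_finite setT leb.
Proof.
exists cube; first by rewrite bigcup_cube.
by move=> k; split; [exact: measurable_box|exact: lebesgue_rV_box_lty].
Qed.

End measurable_boxes.

HB.instance Definition _ (R : realType) (n : nat) :=
  @Measure_isSigmaFinite.Build _ 'rV[R]_n.+1 R (@lebesgue_rV R n)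
    lebesgue_rV_sigma_finite.

(** * Translation invariance and measurability of open sets *)

Section measure_preserving.
Context {R : realType} {d} {T : measurableType d} (mu : {measure set T -> \bar R}%R).
Context (phi : T -> T) (mphi : measurable_fun setT phi).
Hypothesis mu_phi : forall A, measurable A -> mu (phi @^-1` A) = mu A.

Lemma ge0_integral_preserving (f : T -> \bar R) :
  measurable_fun setT f -> (forall x, 0 <= f x) ->
  \int[mu]_x f (phi x) = \int[mu]_x f x.
Proof.
move=> mf f0.
rewrite -(ge0_integral_pushforward mphi mu measurableT mf)//.
by apply: eq_measure_integral => A mA _; exact: mu_phi.
Qed.

Lemma integral_preserving (f : T -> \bar R) :
  measurable_fun setT f -> \int[mu]_x f (phi x) = \int[mu]_x f x.
Proof.
move=> mf; rewrite integralE [RHS]integralE; congr (_ - _).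
- rewrite -(ge0_integral_preserving (measurable_funepos mf) (funepos_ge0 f)).
  by apply: eq_integral => x _; rewrite !funeposE.
- rewrite -(ge0_integral_preserving (measurable_funeneg mf) (funeneg_ge0 f)).
  by apply: eq_integral => x _; rewrite !funenegE.
Qed.

Lemma ae_preserving (P : T -> Prop) :
  {ae mu, forall x, P x} -> {ae mu, forall x, P (phi x)}.
Proof.
move=> [N [mN N0 PN]]; exists (phi @^-1` N); split.
- by rewrite -[X in measurable X]setTI; exact: mphi.
- by rewrite mu_phi.
- by move=> x /= Px; exact: PN.
Qed.

(** For an infinite exponent, the essential supremum is determined by the
measures of the sets where |f| exceeds y, which phi preserves. *)
Lemma Lnorm_preserving (f : T -> \bar R) (p : \bar R) :
  1 <= p -> measurable_fun setT f ->
  'N[mu]_p[f \o phi] = 'N[mu]_p[f].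
Proof.
move=> p1 mf; rewrite unlock; case: p p1 => [p|_|//].
  rewrite lee_fin => p1; congr (_ `^ _).
  apply: (ge0_integral_preserving (f := fun y => `|f y| `^ p)).
    by apply: (measurableT_comp (measurable_poweR p)); exact: measurableT_comp.
  by move=> y; rewrite poweR_ge0.
have maf : measurable_fun setT (abse \o f) by exact: measurableT_comp.
have mafp : measurable_fun setT (abse \o (f \o phi)).
  exact: (measurableT_comp maf mphi).
case: ifPn => // _; rewrite (ess_supEmu0 _ maf) (ess_supEmu0 _ mafp).
have mE y : mu ((abse \o (f \o phi)) @^-1` `]y, +oo[) =
            mu ((abse \o f) @^-1` `]y, +oo[).
  rewrite -[RHS]mu_phi// -[X in measurable X]setTI.
  by apply: maf => //; exact: emeasurable_itv.
by congr (ereal_inf _); apply/seteqP; split => y /=; rewrite mE.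
Qed.

End measure_preserving.

Section translation_invariance.
Context {R : realType} {n : nat}.
Local Notation V := 'rV[R]_n.+1.
Local Notation leb := (@lebesgue_rV R n).

(** The Caratheodory criterion for the preimage of A, tested on X, is the
criterion for A tested on the reflection of X. *)
Lemma measurable_reflection (v : V) {D : set V} :
  measurable_fun D (fun x : V => v - x)%R.
Proof.
apply: measurable_funTS => _ A mA; rewrite setTI.
suff : (@lebesgue_outer R n).-caratheodory [set x | A (v - x)%R] by [].
move=> X.
rewrite -[LHS](lebesgue_outer_reflection v) (mA [set x | X (v - x)%R]).
rewrite -[X in X + _ = _](lebesgue_outer_reflection v).
rewrite -[X in _ + X = _](lebesgue_outer_reflection v).
by congr (_ + _); congr lebesgue_outer; apply/funext => x /=;
  rewrite subKr.
Qed.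

Lemma measurable_translation (v : V) {D : set V} :
  measurable_fun D (fun x : V => x + v)%R.
Proof.
rewrite (_ : (fun _ => _) = (fun x => v - x)%R \o (fun x => 0 - x)%R).
  by apply: measurableT_comp; exact: measurable_reflection.
by apply/funext => x /=; rewrite sub0r opprK addrC.
Qed.

Lemma lebesgue_rV_translation (v : V) (A : set V) :
  leb ((fun x => x + v)%R @^-1` A) = leb A.
Proof.
rewrite -[RHS](lebesgue_outer_reflection v).
rewrite -[RHS](lebesgue_outer_reflection 0).
by congr lebesgue_outer; apply/funext => x /=; rewrite sub0r opprK addrC.
Qed.

Lemma integral_translation (v : V) (f : V -> \bar R) :
  measurable_fun setT f -> \int[leb]_x f (x + v)%R = \int[leb]_x f x.
Proof.
move=> mf; apply: (@integral_preserving R _ _ leb (fun x => x + v)%R _ _ f mf).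
  exact: measurable_translation.
by move=> A _; exact: lebesgue_rV_translation.
Qed.

Lemma ae_reflection (v : V) (P : V -> Prop) :
  {ae leb, forall x, P x} -> {ae leb, forall x, P (v - x)%R}.
Proof.
apply: (@ae_preserving R _ _ leb (fun x => v - x)%R).
  exact: measurable_reflection.
by move=> A _; exact: lebesgue_outer_reflection.
Qed.

Lemma Lnorm_reflection (v : V) (f : V -> R) (p : \bar R) :
  1 <= p -> measurable_fun setT f ->
  'N[leb]_p[EFin \o (fun x => f (v - x)%R)] = 'N[leb]_p[EFin \o f].
Proof.
move=> p1 mf.
apply: (@Lnorm_preserving R _ _ leb (fun x => v - x)%R _ _ (EFin \o f)).
- exact: measurable_reflection.
- by move=> A _; exact: lebesgue_outer_reflection.
- exact: p1.
- exact/measurable_EFinP.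
Qed.

Lemma Lnorm_translation (v : V) (f : V -> R) (p : \bar R) :
  1 <= p -> measurable_fun setT f ->
  'N[leb]_p[EFin \o (fun x => f (x + v)%R)] = 'N[leb]_p[EFin \o f].
Proof.
move=> p1 mf.
apply: (@Lnorm_preserving R _ _ leb (fun x => x + v)%R _ _ (EFin \o f)).
- exact: measurable_translation.
- by move=> A _; exact: lebesgue_rV_translation.
- exact: p1.
- exact/measurable_EFinP.
Qed.

End translation_invariance.

Section topology_measurability.
Context {R : realType} {n : nat}.
Local Notation V := 'rV[R]_n.+1.

Lemma measurable_coord (i : 'I_n.+1) : measurable_fun setT (fun x : V => x ord0 i).
Proof.
move=> mT; apply: (measurability _ (RGenOInfty.measurableE R)) => //.
move=> _ [_ [c ->] <-]; rewrite setTI.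
rewrite (_ : _ @^-1` _ = ~` [set x : V | (x ord0 i <= c)%R]).
  by apply: measurableC; exact: measurable_halfspace.
apply/seteqP; split => x /=; rewrite in_itv/= andbT ltNge; first by move/negP.
by move/negP.
Qed.

(** An open set is the union of the boxes with rational corners that it
contains. *)
Lemma open_measurable_rV (U : set V) : open U -> measurable U.
Proof.
move=> oU.
pose rbox (ab : 'rV[rat]_n.+1 * 'rV[rat]_n.+1) : set V :=
  box (map_mx ratr ab.1) (map_mx ratr ab.2).
rewrite (_ : U = \bigcup_(ab : 'rV[rat]_n.+1 * 'rV[rat]_n.+1)
    (if `[< rbox ab `<=` U >] then rbox ab else set0)).
  apply: countable_bigcupT_measurable => [|ab]; first exact: countableP.
  by case: ifPn => // _; exact: measurable_box.
apply/seteqP; split => [x Ux|x [ab _]]; last by case: asboolP => // rU; exact: rU.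
have /nbhs_ballP[e /= e0 eU] : nbhs x U by exact: open_nbhs_nbhs.
have /choice[a aP] : forall i, exists q : rat,
    ratr q \in `](x ord0 i - e / 2), (x ord0 i)[%R.
  move=> i; have [|q qx] := @rat_in_itvoo R (x ord0 i - e / 2)%R (x ord0 i).
    by rewrite ltrBlDr ltrDl divr_gt0.
  by exists q.
have /choice[b bP] : forall i, exists q : rat,
    ratr q \in `](x ord0 i), (x ord0 i + e / 2)[%R.
  move=> i; have [|q qx] := @rat_in_itvoo R (x ord0 i) (x ord0 i + e / 2)%R.
    by rewrite ltrDl divr_gt0.
  by exists q.
exists (\row_i a i, \row_i b i)%R => //.
rewrite asboolT.
  move=> i; rewrite !mxE.
  have := aP i; have := bP i; rewrite !in_itv/= => /andP[xb _] /andP[_ ->].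
  exact: ltW.
move=> y xy; apply: eU; rewrite -ball_normE/= [ltLHS]mx_normrE.
apply: bigmax_lt => // -[j i] _ /=; rewrite !mxE (ord1 j).
have := xy i; rewrite !mxE.
have := aP i; have := bP i; rewrite !in_itv/=.
move=> /andP[xb bx] /andP[ax xa] /andP[ay yb].
by rewrite ltr_norml; apply/andP; split; lra.
Qed.

Lemma continuous_measurable_rV (f : V -> R) : continuous f -> measurable_fun setT f.
Proof.
move=> cf mT; apply: (measurability _ (RGenOpens.measurableE R)) => //.
move=> _ [_ [a [b ->] <-]]; rewrite setTI.
by apply: open_measurable_rV; apply: open_comp => // x _; exact: cf.
Qed.

End topology_measurability.

(** * Joint measurability of differences *)

Section difference_measurability.
Context {R : realType} {n : nat}.
Local Notation V := 'rV[R]_n.+1.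
Local Notation outer := (@lebesgue_outer R n).
Local Notation leb := (@lebesgue_rV R n).

(** Sets whose preimage under subtraction belongs to the product of the two
Lebesgue sigma-algebras.  They form a sigma-algebra containing the boxes, hence
include all Borel sets, but possibly not all Lebesgue measurable sets. *)
Definition diff_measurable (B : set V) :=
  measurable [set z : V * V | B (z.1 - z.2)%R].

Lemma diff_measurable_bigcup (B : (set V)^nat) :
  (forall k, diff_measurable (B k)) -> diff_measurable (\bigcup_k B k).
Proof.
by move=> dB; have := bigcupT_measurable _ dB.
Qed.

Lemma diff_measurable_bigcap (B : (set V)^nat) :
  (forall k, diff_measurable (B k)) -> diff_measurable (\bigcap_k B k).
Proof.
by move=> dB; have := bigcapT_measurable dB.
Qed.

Lemma diff_measurableU (A B : set V) :
  diff_measurable A -> diff_measurable B -> diff_measurable (A `|` B).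
Proof. by move=> dA dB; have := measurableU _ _ dA dB. Qed.

Lemma diff_measurableD (A B : set V) :
  diff_measurable A -> diff_measurable B -> diff_measurable (A `\` B).
Proof. by move=> dA dB; have := measurableD dA dB. Qed.

Lemma diff_measurable_box (a b : V) : diff_measurable (box a b).
Proof.
have mi i : measurable_fun setT (fun z : V * V => (z.1 - z.2)%R ord0 i).
  rewrite (_ : (fun _ => _) = (fun z : V * V => z.1 ord0 i - z.2 ord0 i)%R).
    apply: measurable_funB.
      exact: (measurableT_comp (measurable_coord i) measurable_fst).
    exact: (measurableT_comp (measurable_coord i) measurable_snd).
  by apply/funext => z; rewrite !mxE.
rewrite /diff_measurable (_ : [set _ | _] = \bigcap_(i in [set: 'I_n.+1])
   [set z : V * V | `]a ord0 i, b ord0 i]%classic ((z.1 - z.2)%R ord0 i)]).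
  apply: fin_bigcap_measurable => // i _.
  by rewrite -[X in measurable X]setTI; apply: mi => //; exact: measurable_itv.
apply/seteqP; split => z /= zab i; first by move=> _ /=; rewrite in_itv/= zab.
by have := zab i I; rewrite /= in_itv.
Qed.

(** Intersect the unions of a sequence of covers by boxes whose total volumes
tend to the outer measure of A. *)
Lemma diff_measurable_hull (A : set V) : outer A < +oo ->
  exists B, [/\ A `<=` B, measurable B, diff_measurable B & leb B = outer A].
Proof.
move=> Aoo.
have Afin : outer A \is a fin_num by rewrite ge0_fin_numE// lebesgue_outer_ge0.
have /choice[c cP] : forall m : nat, exists c : (V * V)^nat, box_cover A c /\
    \sum_(k <oo) box_volume (c k).1 (c k).2 <= outer A + (m.+1%:R^-1)%:E.
  move=> m; have m0 : (0 < m.+1%:R^-1 :> R)%R by rewrite invr_gt0.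
  have [_ [c Ac <-] cA] := lb_ereal_inf_adherent m0 Afin.
  by exists c; split => //; exact: ltW cA.
pose B m := \bigcup_k box (c m k).1 (c m k).2.
have mB m : measurable (B m).
  by apply: bigcupT_measurable => k; exact: measurable_box.
exists (\bigcap_m B m); split.
- by move=> x Ax m _; exact: (cP m).1.
- exact: bigcapT_measurable.
- by apply: diff_measurable_bigcap => m; apply: diff_measurable_bigcup => k;
    exact: diff_measurable_box.
apply/eqP; rewrite eq_le; apply/andP; split; last first.
  by apply: le_lebesgue_outer => x Ax m _; exact: (cP m).1.
apply/lee_addgt0Pr => e e0.
pose m := Num.truncn e^-1.
apply: (@le_trans _ _ (outer A + (m.+1%:R^-1)%:E)); last first.
  rewrite leeD2l// lee_fin invf_ple ?posrE//; exact: ltW (truncnS_gt _).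
apply: le_trans (cP m).2; apply: (@le_trans _ _ (outer (B m))).
  by apply: le_lebesgue_outer => x; apply.
by apply: ereal_inf_lbound; exists (c m).
Qed.

(** On a piece of finite measure, take a hull B of A, then a hull Z of the null
set B \ A: off Z, the sets A and B coincide. *)
Lemma diff_measurable_off_null (A : set V) : measurable A ->
  exists Z, [/\ measurable Z, leb Z = 0, diff_measurable Z &
                diff_measurable (A `\` Z)].
Proof.
move=> mA.
have /choice[Z ZP] : forall k : nat, exists Z, [/\ measurable Z, leb Z = 0,
    diff_measurable Z & diff_measurable ((A `&` cube k) `\` Z)].
  move=> k.
  have mAk : measurable (A `&` cube k).
    by apply: measurableI => //; exact: measurable_box.
  have Akoo : leb (A `&` cube k) < +oo.
    apply: (@le_lt_trans _ _ (leb (cube k))); last exact: lebesgue_rV_box_lty.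
    by apply: le_lebesgue_outer => x [].
  have [B [AB mB dB BA]] := diff_measurable_hull Akoo.
  have BA0 : leb (B `\` (A `&` cube k)) = 0.
    have Boo : leb B < +oo by rewrite BA.
    rewrite measureD// (setIidr AB).
    transitivity (leb B - leb B); first by congr (_ - _); exact/esym/BA.
    by rewrite subee// ge0_fin_numE// lebesgue_outer_ge0.
  have [|Z [BAZ mZ dZ Z0]] := @diff_measurable_hull (B `\` (A `&` cube k)).
    by rewrite -[outer _]/(leb _) BA0.
  exists Z; split => //; first by rewrite Z0.
  rewrite (_ : _ `\` _ = B `\` Z); first exact: diff_measurableD.
  apply/seteqP; split => x [Ax Zx]; first by split => //; exact: AB.
  by split => //; apply: contrapT => Akx; apply: Zx; exact: BAZ.
exists (\bigcup_k Z k); split.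
- by apply: bigcupT_measurable => k; have [] := ZP k.
- apply/eqP; rewrite -measure_le0.
  apply: (le_trans (measure_sigma_subadditive _ _ _ (@subset_refl _ _))).
  + by move=> k; have [] := ZP k.
  + by apply: bigcupT_measurable => k; have [] := ZP k.
  + by rewrite eseries0// => k _ _; have [] := ZP k.
- by apply: diff_measurable_bigcup => k; have [] := ZP k.
rewrite (_ : A `\` _ =
    (\bigcup_k ((A `&` cube k) `\` Z k)) `\` \bigcup_k Z k).
  by apply: diff_measurableD; apply: diff_measurable_bigcup => k; have [] := ZP k.
apply/seteqP; split => x [].
  move=> Ax Zx; split => //.
  have [k _ kx] : (\bigcup_k cube k) x by rewrite bigcup_cube.
  by exists k => //; split => //; apply: contra_not Zx => Zx; exists k.
by move=> [k _ [[Ax _] _]] Zx; split.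
Qed.

(** Set f to 0 on a null set U that contains the exceptional sets of the
countably many superlevel sets {f > q} with q rational, since these determine
all the others. *)
Lemma diff_measurable_version (f : V -> R) : measurable_fun setT f ->
  exists J : V -> R, [/\ measurable_fun setT J,
    {ae leb, forall x, f x = J x} &
    measurable_fun setT (fun z : V * V => J (z.1 - z.2)%R)].
Proof.
move=> mf.
have mfr (c : R) : measurable [set x | (c < f x)%R].
  rewrite (_ : [set _ | _] = setT `&` f @^-1` `]c, +oo[%classic).
    by apply: mf => //; exact: measurable_itv.
  by rewrite setTI; apply/seteqP; split => x /=; rewrite in_itv/= andbT.
have /choice[Z ZP] := fun q : rat => diff_measurable_off_null (mfr (ratr q)).
pose U := \bigcup_q Z q.
have mU : measurable U.
  by apply: bigcupT_measurable_rat => q; have [] := ZP q.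
have U0 : leb.-negligible U.
  (* The rationals are enumerated, as countable unions of negligible sets are
     indexed by nat. *)
  rewrite (_ : U = \bigcup_(k : nat) oapp Z set0 (unpickle k)).
    apply: negligible_bigcup => k; case: unpickle => [q|] /=.
      have [mZ Z0 _ _] := ZP q.
      by exists (Z q); split; [exact: mZ|exact: Z0|].
    exact: negligible_set0.
  apply/seteqP; split => [x [q _ Zx]|x [k _]].
    by exists (pickle q); [exact: I|rewrite pickleK].
  by case: unpickle => //= q Zx; exists q.
have dU : diff_measurable U.
  suff : measurable (\bigcup_q [set z : V * V | Z q (z.1 - z.2)%R]) by [].
  by apply: bigcupT_measurable_rat => q; have [] := ZP q.
exists (f \_ (~` U)); split.
- by apply/(measurable_restrictT _ (measurableC mU)); exact: measurable_funTS.
- apply: filterS (_ : {ae leb, forall x, ~ U x}); last first.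
    by apply: negligibleS U0 => x /=/contrapT.
  by move=> x Ux; rewrite patchE mem_set.
move=> mT; apply: (measurability _ (RGenOInfty.measurableE R)) => //.
move=> _ [_ [c ->] <-]; rewrite setTI.
pose Y q := if (c < ratr q)%R then [set x | (ratr q < f x)%R] `\` Z q else set0.
pose W := \bigcup_q Y q.
have dW : diff_measurable W.
  suff : measurable (\bigcup_q [set z : V * V | Y q (z.1 - z.2)%R]) by [].
  apply: bigcupT_measurable_rat => q; rewrite /Y.
  case: ifPn => _; first by have [] := ZP q.
  exact: (@measurable0 _ (V * V)%type).
(* On U the new function is 0, which exceeds c exactly when c < 0. *)
rewrite (_ : _ @^-1` _ = [set z : V * V |
   ((W `\` U) `|` (if (c < 0)%R then U else set0)) (z.1 - z.2)%R]).
  apply: diff_measurableU; first exact: diff_measurableD.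
  by case: ifPn => // _; exact: (@measurable0 _ (V * V)%type).
apply/seteqP; split => z /=; rewrite in_itv/= andbT patchE; set w := (z.1 - z.2)%R.
  have [wU|wU] := pselect (U w).
    by rewrite memNset/=; [move=> c0; right; rewrite c0|apply].
  rewrite mem_set// => cfw; left; split => //.
  have [q] := rat_in_itvoo cfw; rewrite in_itv/= => /andP[cq qf].
  exists q => //; rewrite /Y cq; split => // Zw; apply: wU; by exists q.
move=> [[[q _]]|].
  rewrite /Y; case: ifPn => // cq [/= qf _] wU; rewrite mem_set//.
  exact: lt_trans cq qf.
by case: ifPn => // c0 Uw; rewrite memNset/=; [exact: c0|apply].
Qed.

End difference_measurability.

(** * Hoelder inequalities *)

Section hoelder_inequalities.
Context {R : realType}.

(** This is u <= exp (u - 1) raised to the power a. *)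
Lemma powR_le_expR (u a : R) : (0 <= u)%R -> (0 <= a)%R ->
  (u `^ a <= expR (a * (u - 1)))%R.
Proof.
move=> u0 a0; rewrite mulrC expRM; apply: ge0_ler_powR => //.
  by rewrite nnegrE expR_ge0.
by have := expR_ge1Dx (u - 1)%R; rewrite addrC subrK.
Qed.

(** Divide x, y, z by the weighted mean M and multiply the three bounds
u^a <= exp (a (u - 1)): the exponents then add up to M / M - 1 = 0.  If M = 0,
then x = 0 because a is positive, and both sides vanish. *)
Lemma weighted_AGM3 (x y z a b c : R) : (0 <= x)%R -> (0 <= y)%R -> (0 <= z)%R ->
  (0 < a)%R -> (0 <= b)%R -> (0 <= c)%R -> (a + b + c = 1)%R ->
  (x `^ a * y `^ b * z `^ c <= a * x + b * y + c * z)%R.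
Proof.
move=> x0 y0 z0 a0 b0 c0 abc.
set M := (a * x + b * y + c * z)%R.
have ax0 : (0 <= a * x)%R by rewrite mulr_ge0// ltW.
have by0 : (0 <= b * y)%R by rewrite mulr_ge0.
have cz0 : (0 <= c * z)%R by rewrite mulr_ge0.
have : (0 <= M)%R by rewrite !addr_ge0.
rewrite le_eqVlt => /predU1P[M0|M0].
  have /eqP : (a * x = 0)%R by rewrite /M in M0; lra.
  rewrite mulf_eq0 gt_eqF//= => /eqP ->.
  by rewrite powR0 ?gt_eqF// !mul0r -M0.
have Mi : (0 <= M^-1)%R by rewrite invr_ge0 ltW.
have M1 : (M = M `^ a * M `^ b * M `^ c)%R.
  rewrite -powRD; last by apply/implyP => _; rewrite gt_eqF.
  rewrite -powRD; last by apply/implyP => _; rewrite gt_eqF.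
  by rewrite abc powRr1// ltW.
have le1 : ((x / M) `^ a * (y / M) `^ b * (z / M) `^ c <= 1)%R.
  apply: (@le_trans _ _ (expR (a * (x / M - 1)) * expR (b * (y / M - 1)) *
                         expR (c * (z / M - 1))))%R.
    by rewrite !ler_pM ?mulr_ge0 ?powR_ge0// powR_le_expR ?divr_ge0// ?ltW.
  rewrite -!expRD (_ : (_ + _ + _)%R = 0%R) ?expR0//.
  rewrite (_ : (_ + _ + _)%R = (M / M - (a + b + c))%R); last by rewrite /M; ring.
  by rewrite abc divff ?subrr// gt_eqF.
rewrite -[in leRHS](mul1r M) [in leRHS]M1.
have -> : (x `^ a * y `^ b * z `^ c = (x / M) `^ a * (y / M) `^ b * (z / M) `^ c *
     (M `^ a * M `^ b * M `^ c))%R.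
  rewrite -[in LHS](divfK (lt0r_neq0 M0) x) -[in LHS](divfK (lt0r_neq0 M0) y).
  rewrite -[in LHS](divfK (lt0r_neq0 M0) z) !powRM ?divr_ge0// ?ltW//.
  by ring.
by rewrite ler_wpM2r// -M1 ltW.
Qed.

Lemma powR_split (x t a b : R) : (0 <= x)%R -> (t == 0)%R = false ->
  (a + b = t^-1)%R -> ((x `^ t) `^ a * (x `^ t) `^ b = x)%R.
Proof.
move=> x0 t0 abt; rewrite -(powRD (x := (x `^ t)%R)) abt ?invr_eq0 ?t0//.
by rewrite -powRrM mulfV ?t0// powRr1.
Qed.

Context d {T : measurableType d} (mu : {measure set T -> \bar R}%R).

(** Let s > 0 bound the right-hand side.  Pointwise, f g is
s^a (f^r g^p / s)^a (f^r)^b (g^p)^c with weights a = 1/q, b = 1 - 1/p and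
c = 1 - 1/r of sum 1, so [weighted_AGM3] bounds it by a sum whose integral is at
most s^a (a + b + c) = s^a.  Letting s decrease to the right-hand side also
covers the case where the latter is 0. *)
Lemma hoelder3_normalized (f g : T -> R) (p q r : R) :
  measurable_fun setT f -> measurable_fun setT g ->
  (forall x, 0 <= f x)%R -> (forall x, 0 <= g x)%R ->
  (1 <= p)%R -> (1 <= q)%R -> (1 <= r)%R -> (q^-1 = p^-1 + r^-1 - 1)%R ->
  \int[mu]_x (f x `^ r)%:E <= 1 -> \int[mu]_x (g x `^ p)%:E <= 1 ->
  (\int[mu]_x (f x * g x)%:E) `^ q <= \int[mu]_x (f x `^ r * g x `^ p)%:E.
Proof.
move=> mf mg f0 g0 p1 q1 r1 pqr f1 g1.
have p0 : (0 < p)%R by rewrite (lt_le_trans ltr01).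
have q0 : (0 < q)%R by rewrite (lt_le_trans ltr01).
have r0 : (0 < r)%R by rewrite (lt_le_trans ltr01).
have mfr : measurable_fun setT (fun x => f x `^ r)%R.
  exact: (measurableT_comp (measurable_powR r)).
have mgp : measurable_fun setT (fun x => g x `^ p)%R.
  exact: (measurableT_comp (measurable_powR p)).
set I := leRHS.
have I0 : 0 <= I.
  by apply: integral_ge0 => x _; rewrite lee_fin mulr_ge0// powR_ge0.
suff bound (s : R) : (0 < s)%R -> I <= s%:E ->
    (\int[mu]_x (f x * g x)%:E) `^ q <= s%:E.
  case: (I) I0 bound => [s|_ _|//]; last by rewrite leey.
  rewrite lee_fin => s0 bound; apply/lee_addgt0Pr => e e0.
  by rewrite -EFinD; apply: bound; rewrite ?lee_fin; lra.
move=> s0 Is.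
pose a := (q^-1)%R; pose b := (1 - p^-1)%R; pose c := (1 - r^-1)%R.
have a0 : (0 < a)%R by rewrite invr_gt0.
have b0 : (0 <= b)%R by rewrite subr_ge0 invf_le1.
have c0 : (0 <= c)%R by rewrite subr_ge0 invf_le1.
have abc : (a + b + c = 1)%R by rewrite /a /b /c pqr; lra.
have pow (x : T) : (f x * g x <= s `^ a * (a * (f x `^ r * g x `^ p / s) +
    b * f x `^ r + c * g x `^ p))%R.
  have -> : (f x * g x = s `^ a * ((f x `^ r * g x `^ p / s) `^ a *
      (f x `^ r) `^ b * (g x `^ p) `^ c))%R.
    have si0 : (0 <= s^-1)%R by rewrite invr_ge0 ltW.
    rewrite !powRM ?mulr_ge0 ?powR_ge0//.
    have mulr_regroup (A B C D E G : R) :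
        (A * (B * C * D * E * G) = (A * D) * (B * E) * (C * G))%R by ring.
    rewrite mulr_regroup.
    rewrite -powRM// ?(ltW s0)// divff ?gt_eqF// powR1 mul1r.
    have rab : (a + b = r^-1)%R by rewrite /a /b pqr; lra.
    have pac : (a + c = p^-1)%R by rewrite /a /c pqr; lra.
    congr (_ * _)%R; first exact: (esym (powR_split (f0 x) (gt_eqF r0) rab)).
    exact: (esym (powR_split (g0 x) (gt_eqF p0) pac)).
  apply: ler_wpM2l; first exact: powR_ge0.
  apply: weighted_AGM3 => //; rewrite ?powR_ge0//.
  by rewrite divr_ge0 ?mulr_ge0 ?powR_ge0// ltW.
have le1 : \int[mu]_x (f x * g x)%:E <= (s `^ a)%:E.
  apply: (@le_trans _ _ (\int[mu]_x ((s `^ a)%:E *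
      ((a / s)%:E * (f x `^ r * g x `^ p)%:E + b%:E * (f x `^ r)%:E +
       c%:E * (g x `^ p)%:E)))).
    apply: ge0_le_integral => //.
    - by move=> x _; rewrite lee_fin mulr_ge0.
    - by apply/measurable_EFinP; exact: measurable_funM.
    - apply: emeasurable_funM => //; apply: emeasurable_funD; first apply: emeasurable_funD.
      + by apply: emeasurable_funM => //; apply/measurable_EFinP; exact: measurable_funM.
      + by apply: emeasurable_funM => //; exact/measurable_EFinP.
      + by apply: emeasurable_funM => //; exact/measurable_EFinP.
    - move=> x _; rewrite -!EFinM lee_fin.
      apply: (le_trans (pow x)); rewrite le_eqVlt; apply/orP; left; apply/eqP.
      by congr (_ * _)%R; ring.
  have a_ge0 := ltW a0; have si_ge0 : (0 <= s^-1)%R by rewrite invr_ge0 ltW.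
  have mfg : measurable_fun setT (fun x => f x `^ r * g x `^ p)%R.
    exact: measurable_funM.
  rewrite ge0_integralZl//; last 3 first.
  - apply: emeasurable_funD; first apply: emeasurable_funD.
      + by apply: emeasurable_funM => //; exact/measurable_EFinP.
      + by apply: emeasurable_funM => //; exact/measurable_EFinP.
      + by apply: emeasurable_funM => //; exact/measurable_EFinP.
  - by move=> x _; rewrite -!EFinM lee_fin !addr_ge0// !mulr_ge0 ?powR_ge0.
  - by rewrite lee_fin powR_ge0.
  rewrite -[leRHS]mule1 lee_pmul2l ?lte_fin ?powR_gt0//.
  rewrite ge0_integralD//; last 4 first.
  - by move=> x _; rewrite -!EFinM lee_fin !addr_ge0// !mulr_ge0 ?powR_ge0.
  - apply: emeasurable_funD.
      + by apply: emeasurable_funM => //; exact/measurable_EFinP.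
      + by apply: emeasurable_funM => //; exact/measurable_EFinP.
  - by move=> x _; rewrite -!EFinM lee_fin !mulr_ge0 ?powR_ge0.
  - by apply: emeasurable_funM => //; exact/measurable_EFinP.
  rewrite ge0_integralD//; last 4 first.
  - by move=> x _; rewrite -!EFinM lee_fin !mulr_ge0 ?powR_ge0.
  - by apply: emeasurable_funM => //; exact/measurable_EFinP.
  - by move=> x _; rewrite -!EFinM lee_fin !mulr_ge0 ?powR_ge0.
  - by apply: emeasurable_funM => //; exact/measurable_EFinP.
  have as0 : (0 <= a / s)%R by rewrite mulr_ge0.
  have mEfr : measurable_fun setT (fun x => (f x `^ r)%:E) by exact/measurable_EFinP.
  have mEgp : measurable_fun setT (fun x => (g x `^ p)%:E) by exact/measurable_EFinP.
  have mEfg : measurable_fun setT (fun x => (f x `^ r * g x `^ p)%:E).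
    exact/measurable_EFinP.
  have pow0 (h : T -> R) (t : R) x : setT x -> 0 <= (h x `^ t)%:E.
    by move=> _; rewrite lee_fin powR_ge0.
  rewrite (ge0_integralZl _ _ mEfr (pow0 f r))// (ge0_integralZl _ _ mEgp (pow0 g p))//.
  rewrite (ge0_integralZl _ _ mEfg)//; last first.
    by move=> x _; rewrite lee_fin mulr_ge0 ?powR_ge0.
  apply: (@le_trans _ _ ((a / s)%:E * s%:E + b%:E * 1 + c%:E * 1)).
    apply: leeD; first apply: leeD.
    - by apply: lee_wpmul2l; first by rewrite lee_fin.
    - by apply: lee_wpmul2l; first by rewrite lee_fin.
    - by apply: lee_wpmul2l; first by rewrite lee_fin.
  by rewrite -!EFinM lee_fin !mulr1 divfK ?gt_eqF// abc.
apply: (@le_trans _ _ ((s `^ a)%:E `^ q)).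
  apply: gt0_ler_poweR; rewrite ?in_itv/= ?leey ?andbT ?lee_fin ?powR_ge0//.
    exact: ltW.
  by apply: integral_ge0 => x _; rewrite lee_fin mulr_ge0.
by rewrite poweR_EFin -powRrM /a mulVf ?gt_eqF// powRr1 ?lexx// ltW.
Qed.

Lemma Lnorm1y_hoelder (f g : T -> R) : 0 < mu setT ->
  measurable_fun setT f -> measurable_fun setT g ->
  'N[mu]_1[EFin \o f] < +oo -> 'N[mu]_+oo[EFin \o g] < +oo ->
  \int[mu]_x `|(f x * g x)%:E| <= 'N[mu]_1[EFin \o f] * 'N[mu]_+oo[EFin \o g].
Proof.
move=> mu0 mf mg f1 gy.
have Nfin : 'N[mu]_+oo[EFin \o g] \is a fin_num.
  by rewrite ge0_fin_numE ?Lnorm_ge0.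
have gle : {ae mu, forall x, `|(g x)%:E| <= 'N[mu]_+oo[EFin \o g]}.
  by rewrite unlock mu0; exact: ess_sup_ge.
have mEf : measurable_fun setT (EFin \o f) by exact/measurable_EFinP.
have maf : measurable_fun setT (fun x => `|(EFin \o f) x|).
  exact: measurableT_comp.
rewrite Lnorm1 -ge0_integralZr ?Lnorm_ge0//.
apply: ae_ge0_le_integral => //.
- by apply: measurableT_comp => //; apply/measurable_EFinP; exact: measurable_funM.
- by move=> x _; rewrite mule_ge0 ?Lnorm_ge0.
- exact: emeasurable_funM.
- by apply: filterS gle => x gx _; rewrite EFinM abseM lee_pmul.
Qed.

(** When one exponent is infinite, 1/p + 1/r = 1 forces the other one to be 1,
which is the case of [Lnorm1y_hoelder]. *)
Lemma ehoelder (f g : T -> R) (p r : \bar R) : 0 < mu setT ->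
  measurable_fun setT f -> measurable_fun setT g ->
  1 <= p -> 1 <= r -> p^-1 + r^-1 = 1 ->
  'N[mu]_r[EFin \o f] < +oo -> 'N[mu]_p[EFin \o g] < +oo ->
  \int[mu]_x `|(f x * g x)%:E| <= 'N[mu]_r[EFin \o f] * 'N[mu]_p[EFin \o g].
Proof.
move=> mu0 mf mg; case: p => [p| |//].
- case: r => [r| |//].
  + rewrite !lee_fin => p1 r1.
    have p0 : (0 < p)%R by rewrite (lt_le_trans ltr01).
    have r0 : (0 < r)%R by rewrite (lt_le_trans ltr01).
    rewrite !inver !gt_eqF// -EFinD => -[pr] _ _.
    have := hoelder mu mf mg r0 p0; rewrite addrC pr => /(_ erefl).
    by rewrite Lnorm1.
  + move=> p1 _; rewrite invey adde0 => /eqP; rewrite inve_eq1 => /eqP -> fy g1.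
    rewrite muleC (le_trans _ (Lnorm1y_hoelder mu0 mg mf g1 fy))//.
    by under eq_integral do rewrite mulrC.
- move=> _ r1; rewrite invey add0e => /eqP; rewrite inve_eq1 => /eqP ->.
  exact: Lnorm1y_hoelder.
Qed.

Lemma ge0_le_Lnorm (f g : T -> \bar R) (p : \bar R) : 1 <= p ->
  measurable_fun setT f -> measurable_fun setT g ->
  (forall x, `|f x| <= `|g x|) -> 'N[mu]_p[f] <= 'N[mu]_p[g].
Proof.
move=> p1 mf mg fg; rewrite unlock; case: p p1 => [p|_|//].
- rewrite lee_fin => p1; have p0 : (0 < p)%R by rewrite (lt_le_trans ltr01).
  have mpow (h : T -> \bar R) : measurable_fun setT h ->
      measurable_fun setT (fun x => `|h x| `^ p).
    move=> mh; apply: (measurableT_comp (measurable_poweR p)).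
    exact: measurableT_comp.
  apply: gt0_ler_poweR; rewrite ?in_itv/= ?leey ?andbT ?invr_ge0 ?integral_ge0//.
  - exact: ltW.
  - by move=> x _; rewrite poweR_ge0.
  - by move=> x _; rewrite poweR_ge0.
  apply: ge0_le_integral => //; [|exact: mpow|exact: mpow|].
    by move=> x _; rewrite poweR_ge0.
  by move=> x _; apply: (gt0_ler_poweR (ltW p0)); rewrite ?in_itv/= ?leey ?abse_ge0.
- by case: ifPn => // mu0; apply: le_ess_sup; exact/nearW.
Qed.

Lemma ae_eq_Lnorm (f g : T -> \bar R) (p : \bar R) : 1 <= p ->
  measurable_fun setT f -> measurable_fun setT g ->
  {ae mu, forall x, f x = g x} -> 'N[mu]_p[f] = 'N[mu]_p[g].
Proof.
move=> p1 mf mg fg; rewrite unlock; case: p p1 => [p|_|//].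
- rewrite lee_fin => p1.
  have mpow (h : T -> \bar R) : measurable_fun setT h ->
      measurable_fun setT (fun x => `|h x| `^ p).
    move=> mh; apply: (measurableT_comp (measurable_poweR p)).
    exact: measurableT_comp.
  congr (_ `^ _); apply: ge0_ae_eq_integral => //.
  - exact: mpow.
  - exact: mpow.
  - by move=> x _; rewrite poweR_ge0.
  - by move=> x _; rewrite poweR_ge0.
  - by apply: filterS fg => x /= -> _.
- by case: ifPn => // mu0; apply: eq_ess_sup; apply: filterS fg => x /= ->.
Qed.

(** For finite q this follows from the pointwise bound |h| <= 1 + |h|^q. *)
Lemma Lnorm_lty_integral_lty (h : T -> \bar R) (q : \bar R) (B : set T) :
  0 < mu setT -> 1 <= q -> measurable_fun setT h -> measurable B -> mu B < +oo ->
  'N[mu]_q[h] < +oo -> \int[mu]_(x in B) `|h x| < +oo.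
Proof.
move=> mu0 q1 mh mB Boo; rewrite unlock; case: q q1 => [q|_|//].
- rewrite lee_fin => q1; have q0 : (0 < q)%R by rewrite (lt_le_trans ltr01).
  move=> /(lty_poweRy (lt0r_neq0 (_ : 0 < q^-1)%R)); rewrite invr_gt0 => /(_ q0) hq.
  have mpow : measurable_fun setT (fun x => `|h x| `^ q).
    apply: (measurableT_comp (measurable_poweR q)); exact: measurableT_comp.
  apply: (@le_lt_trans _ _ (\int[mu]_(x in B) (1 + `|h x| `^ q))).
    apply: ge0_le_integral => //.
    - by apply: measurable_funTS; exact: measurableT_comp.
    - by apply: emeasurable_funD => //; exact: measurable_funTS.
    move=> x _; have [h1|h1] := leP `|h x| 1.
      by rewrite (le_trans h1)// leeDl// poweR_ge0.
    apply: (@le_trans _ _ (`|h x| `^ q)); last by rewrite leeDr.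
    case: (`|h x|) h1 => [y||//]; last by rewrite poweRyr ?gt_eqF.
    by rewrite lte_fin poweR_EFin lee_fin => y1; rewrite -[leLHS]powRr1 ?ler_powR//; lra.
  rewrite ge0_integralD//; last 2 first.
  - by move=> x _; rewrite poweR_ge0.
  - exact: measurable_funTS.
  rewrite integral_cst// mul1e lte_add_pinfty// (le_lt_trans _ hq)//.
  apply: ge0_subset_integral => //.
  by move=> x _; rewrite poweR_ge0.
- rewrite mu0 => hy; set C := ess_sup mu (abse \o h) in hy.
  have C0 : 0 <= C by apply: ess_sup_gee => //; apply: nearW => x /=.
  have Cfin : C \is a fin_num by rewrite ge0_fin_numE.
  apply: (@le_lt_trans _ _ (\int[mu]_(x in B) (fine C)%:E)).
    apply: ae_ge0_le_integral => //.
    - by apply: measurable_funTS; exact: measurableT_comp.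
    - by move=> x _; rewrite lee_fin fine_ge0.
    - by apply: filterS (ess_sup_ge mu (abse \o h)) => x hx _; rewrite fineK.
  by rewrite integral_cst// fineK// lte_mul_pinfty.
Qed.

End hoelder_inequalities.

(** * Young's inequality for kernels *)

Lemma LnormyE {R : realType} {d} {T : measurableType d}
    (mu : {measure set T -> \bar R}%R) (f : T -> \bar R) : 0 < mu setT ->
  'N[mu]_+oo[f] = ess_sup mu (abse \o f).
Proof. by move=> mu0; rewrite unlock mu0. Qed.

Section kernel_young.
Context {R : realType} {d1 d2} {T1 : measurableType d1} {T2 : measurableType d2}.
Context (m1 : {sigma_finite_measure set T1 -> \bar R}%R)
        (m2 : {sigma_finite_measure set T2 -> \bar R}%R).

Lemma measurable_kernel_section1 (K : T1 * T2 -> R) (x : T1) :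
  measurable_fun setT K -> measurable_fun setT (fun y => K (x, y)).
Proof. by move=> mK; exact: (measurableT_comp mK (pair1_measurable x)). Qed.

Lemma measurable_kernel_section2 (K : T1 * T2 -> R) (y : T2) :
  measurable_fun setT K -> measurable_fun setT (fun x => K (x, y)).
Proof. by move=> mK; exact: (measurableT_comp mK (pair2_measurable y)). Qed.

(** Apply [hoelder3_normalized] to each section K(x, .), then integrate in x
first: the factor int K(x, y)^r dx is at most 1 for every y. *)
Lemma kernel_young_normalized (K : T1 * T2 -> R) (g : T2 -> R) (p q r : R) :
  measurable_fun setT K -> measurable_fun setT g ->
  (forall z, 0 <= K z)%R -> (forall y, 0 <= g y)%R ->
  (1 <= p)%R -> (1 <= q)%R -> (1 <= r)%R -> (q^-1 = p^-1 + r^-1 - 1)%R ->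
  (forall x, \int[m2]_y (K (x, y) `^ r)%:E <= 1) ->
  (forall y, \int[m1]_x (K (x, y) `^ r)%:E <= 1) ->
  \int[m2]_y (g y `^ p)%:E <= 1 ->
  \int[m1]_x (\int[m2]_y (K (x, y) * g y)%:E) `^ q <= 1.
Proof.
move=> mK mg K0 g0 p1 q1 r1 pqr K1 K2 g1.
have mKr : measurable_fun setT (fun z => K z `^ r)%R.
  exact: (measurableT_comp (measurable_powR r)).
have mgp : measurable_fun setT (fun y => g y `^ p)%R.
  exact: (measurableT_comp (measurable_powR p)).
have mgz : measurable_fun setT (fun z : T1 * T2 => g z.2).
  exact: (measurableT_comp mg measurable_snd).
have mgpz : measurable_fun setT (fun z : T1 * T2 => g z.2 `^ p)%R.
  exact: (measurableT_comp mgp measurable_snd).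
have mk : measurable_fun setT (fun z => (K z `^ r * g z.2 `^ p)%:E).
  by apply/measurable_EFinP; exact: measurable_funM.
have k0 z : 0 <= (K z `^ r * g z.2 `^ p)%:E.
  by rewrite lee_fin mulr_ge0 ?powR_ge0.
have mF : measurable_fun setT (fun x => \int[m2]_y (K (x, y) * g y)%:E).
  apply: (measurable_fun_fubini_tonelli_F (m2 := m2) (fun z => (K z * g z.2)%:E)).
    by apply/measurable_EFinP; exact: measurable_funM.
  by move=> z; rewrite lee_fin mulr_ge0.
apply: (@le_trans _ _ (\int[m1]_x \int[m2]_y (K (x, y) `^ r * g y `^ p)%:E)).
  apply: ge0_le_integral => //.
  - by move=> x _; rewrite poweR_ge0.
  - exact: (measurableT_comp (measurable_poweR q)).
  - exact: (measurable_fun_fubini_tonelli_F (m2 := m2) _ mk k0).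
  - move=> x _; apply: (@hoelder3_normalized _ _ _ m2 (fun y => K (x, y))) => //.
    exact: measurable_kernel_section1.
rewrite (fubini_tonelli _ mk k0)/=.
apply: le_trans g1; apply: ge0_le_integral => //.
- by move=> y _; apply: integral_ge0 => x _; exact: (k0 (x, y)).
- exact: (measurable_fun_fubini_tonelli_G (m1 := m1) _ mk k0).
- exact/measurable_EFinP.
- move=> y _; under eq_integral do rewrite EFinM.
  rewrite ge0_integralZr//.
  + by rewrite -[leRHS]mul1e lee_wpmul2r// lee_fin powR_ge0.
  + by apply/measurable_EFinP; exact: (measurable_kernel_section2 y mKr).
  + by move=> x _; rewrite lee_fin powR_ge0.
  + by rewrite lee_fin powR_ge0.
Qed.

Lemma Lnorm_normalized_le1 {d} {T : measurableType d}
    (mu : {measure set T -> \bar R}%R) (f : T -> R) (p A : R) :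
  measurable_fun setT f -> (1 <= p)%R -> (0 < A)%R ->
  'N[mu]_p%:E[EFin \o f] <= A%:E ->
  \int[mu]_x ((`|f x| / A) `^ p)%:E <= 1.
Proof.
move=> mf p1 A0 fA.
have p0 : (0 < p)%R by rewrite (lt_le_trans ltr01).
have mfp : measurable_fun setT (fun x => (`|f x| `^ p)%:E).
  apply/measurable_EFinP; apply: (measurableT_comp (measurable_powR p)).
  exact: measurableT_comp.
under eq_integral do rewrite powRM ?invr_ge0 ?(ltW A0)// EFinM.
rewrite (ge0_integralZr mu measurableT mfp) ?lee_fin ?powR_ge0//.
have -> : \int[mu]_x (`|f x| `^ p)%:E = 'N[mu]_p%:E[EFin \o f] `^ p.
  by rewrite poweR_Lnorm ?gt_eqF.
apply: (@le_trans _ _ ((A%:E `^ p) * (A^-1 `^ p)%:E)).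
  rewrite lee_wpmul2r ?lee_fin ?powR_ge0//.
  apply: (gt0_ler_poweR (ltW p0)); rewrite ?in_itv/= ?leey ?andbT ?Lnorm_ge0//.
  by rewrite lee_fin ltW.
rewrite poweR_EFin -EFinM -powRM ?invr_ge0 ?(ltW A0)//.
by rewrite divff ?gt_eqF// powR1.
Qed.

(** The exponents leave three situations: q infinite, where p and r are
conjugate; A = 0 or g of norm 0, where the integrals vanish; and otherwise
p, q, r are all finite and dividing K by A and g by its norm leads to
[kernel_young_normalized]. *)
Lemma kernel_young (K : T1 * T2 -> R) (g : T2 -> R) (p q r : \bar R) (A : R) :
  0 < m1 setT -> 0 < m2 setT -> measurable_fun setT K -> measurable_fun setT g ->
  1 <= p -> 1 <= q -> 1 <= r -> q^-1 = p^-1 + r^-1 - 1 -> (0 <= A)%R ->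
  (forall x, 'N[m2]_r[EFin \o (fun y => K (x, y))] <= A%:E) ->
  (forall y, 'N[m1]_r[EFin \o (fun x => K (x, y))] <= A%:E) ->
  'N[m2]_p[EFin \o g] < +oo ->
  'N[m1]_q[(fun x => \int[m2]_y `|(K (x, y) * g y)%:E|)] <=
    A%:E * 'N[m2]_p[EFin \o g].
Proof.
move=> m1T m2T mK mg p1 q1 r1 pqr A0 K1 K2 gp.
have p0 : 0 < p by rewrite (lt_le_trans lte01).
have q0 : 0 < q by rewrite (lt_le_trans lte01).
have r0 : 0 < r by rewrite (lt_le_trans lte01).
have mK1 x := measurable_kernel_section1 x mK.
have mK2 y := measurable_kernel_section2 y mK.
have mEKg x : measurable_fun setT (fun y => `|(K (x, y) * g y)%:E|).
  by apply: measurableT_comp => //; apply/measurable_EFinP; exact: measurable_funM.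
have int0 x : {ae m2, forall y, (K (x, y) * g y = 0)%R} ->
    \int[m2]_y `|(K (x, y) * g y)%:E| = 0.
  move=> Kg0; rewrite (ge0_ae_eq_integral (g := cst 0)) ?integral0//.
  by apply: filterS Kg0 => y -> _; rewrite abse0.
have norm0 : (forall x, \int[m2]_y `|(K (x, y) * g y)%:E| = 0) ->
    'N[m1]_q[(fun x => \int[m2]_y `|(K (x, y) * g y)%:E|)] <=
      A%:E * 'N[m2]_p[EFin \o g].
  move=> K0; rewrite (_ : (fun _ => _) = cst 0); last exact/funext.
  by rewrite Lnorm0 ?gt_eqF// mule_ge0 ?Lnorm_ge0.
case: q q1 pqr q0 int0 norm0 => [q| |//]; last first.
  rewrite invey => _ pr _ _ _; rewrite LnormyE//; apply/ess_supP; apply: nearW => x /=.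
  rewrite gee0_abs ?integral_ge0//.
  have {}pr : p^-1 + r^-1 = 1.
    move: pr; case: (p) p1 => [s| |//]; case: (r) r1 => [t| |//]; rewrite ?invey.
    - rewrite !lee_fin => t1 s1; rewrite !inver !gt_eqF ?(lt_le_trans ltr01)//.
      by move=> /(congr1 fine)/= st; congr EFin; lra.
    - rewrite !lee_fin => _ s1; rewrite !inver !gt_eqF ?(lt_le_trans ltr01)//.
      by move=> /(congr1 fine)/= st; congr EFin; lra.
    - rewrite !lee_fin => t1 _; rewrite !inver !gt_eqF ?(lt_le_trans ltr01)//.
      by move=> /(congr1 fine)/= st; congr EFin; lra.
    - by move=> _ _; move=> /(congr1 fine)/= /eqP; rewrite addr0 sub0r eq_sym oppr_eq0 oner_eq0.
  have := ehoelder (p := p) (r := r) m2T (mK1 x) mg p1 r1 pr.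
  move=> /(_ (le_lt_trans (K1 x) (ltry _)) gp) /le_trans; apply.
  by rewrite lee_wpmul2r// Lnorm_ge0.
rewrite lee_fin lte_fin => q1 + q0 int0 norm0.
case: p p1 p0 gp int0 norm0 => [p| |//]; last first.
  move=> _ _ _ _ _; rewrite invey add0e inver gt_eqF//.
  case: r r1 r0 K1 K2 => [r| |//]; rewrite ?invey.
    rewrite lee_fin lte_fin => r1 r0 _ _; rewrite inver gt_eqF// => /(congr1 fine)/= qr.
    have r1' : (r^-1 <= 1)%R by rewrite invf_le1.
    have : (q^-1 <= 0)%R by lra.
    by rewrite leNgt invr_gt0 q0.
  move=> _ _ _ _ /(congr1 fine)/= qr.
  have : (q^-1 <= 0)%R by lra.
  by rewrite leNgt invr_gt0 q0.
case: r r1 r0 K1 K2 => [r| |//]; last first.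
  rewrite lee_fin lte_fin => _ _ _ _ p1 p0 gp _ _; rewrite invey adde0.
  rewrite !inver !gt_eqF// => /(congr1 fine)/= qr.
  have p1' : (p^-1 <= 1)%R by rewrite invf_le1.
  have : (q^-1 <= 0)%R by lra.
  by rewrite leNgt invr_gt0 q0.
rewrite !lee_fin !lte_fin => r1 r0 K1 K2 p1 p0 gp int0 norm0.
rewrite !inver !gt_eqF// => /(congr1 fine)/= pqr.
(* A null kernel or a null function cannot be normalised. *)
move: A0; rewrite le_eqVlt => /predU1P[A0|A0].
  apply: norm0 => x; apply: int0.
  have : 'N[m2]_r%:E[EFin \o (fun y => K (x, y))] = 0.
    by apply/eqP; rewrite eq_le Lnorm_ge0 andbT (le_trans (K1 x))// -A0.
  move=> /Lnorm_eq0_eq0 => /(_ (measurableT_comp _ (mK1 x)) _).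
  rewrite lte_fin => /(_ _ r0) K0.
  by apply: filterS (K0 _) => // y /(_ I) [->]; rewrite mul0r.
have : 0 <= 'N[m2]_p%:E[EFin \o g] by exact: Lnorm_ge0.
have Bfin : 'N[m2]_p%:E[EFin \o g] \is a fin_num by rewrite ge0_fin_numE ?Lnorm_ge0.
rewrite le_eqVlt => /predU1P[B0|B0].
  apply: norm0 => x; apply: int0.
  have mEg : measurable_fun setT (EFin \o g) by exact/measurable_EFinP.
  apply: filterS (Lnorm_eq0_eq0 mEg _ (esym B0)); last by rewrite lte_fin.
  by move=> y /(_ I) [->]; rewrite mulr0.
set B := fine 'N[m2]_p%:E[EFin \o g].
have {}B0 : (0 < B)%R by rewrite fine_gt0// B0 ltey_eq Bfin.
have AB0 : (0 < A * B)%R by rewrite mulr_gt0.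
pose K' z := (`|K z| / A)%R; pose g' y := (`|g y| / B)%R.
have mK' : measurable_fun setT K'.
  by apply: measurable_funM => //; exact: measurableT_comp.
have mg' : measurable_fun setT g'.
  by apply: measurable_funM => //; exact: measurableT_comp.
have K'0 z : (0 <= K' z)%R by rewrite divr_ge0// ltW.
have g'0 y : (0 <= g' y)%R by rewrite divr_ge0// ltW.
have intE x : \int[m2]_y `|(K (x, y) * g y)%:E| =
    (A * B)%:E * \int[m2]_y (K' (x, y) * g' y)%:E.
  rewrite -ge0_integralZl//.
  - apply: eq_integral => y _; rewrite -EFinM/= normrM /K' /g'; congr EFin.
    by field; rewrite !gt_eqF.
  - apply/measurable_EFinP; apply: measurable_funM => //.
    exact: measurable_kernel_section1.
  - by move=> y _; rewrite lee_fin mulr_ge0.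
  - by rewrite lee_fin ltW.
have le1 : \int[m1]_x (\int[m2]_y (K' (x, y) * g' y)%:E) `^ q <= 1.
  apply: (kernel_young_normalized (p := p) (r := r)) => //.
  - by move=> x; exact: Lnorm_normalized_le1.
  - by move=> y; exact: Lnorm_normalized_le1.
  - by apply: Lnorm_normalized_le1 => //; rewrite fineK.
have int_ge0 x : 0 <= \int[m2]_y (K' (x, y) * g' y)%:E.
  by apply: integral_ge0 => y _; rewrite lee_fin mulr_ge0.
have -> : A%:E * 'N[m2]_p%:E[EFin \o g] = (A * B)%:E by rewrite EFinM fineK.
rewrite unlock.
under eq_integral do rewrite intE gee0_abs ?mule_ge0 ?lee_fin ?(ltW AB0)//
  poweRM ?lee_fin ?(ltW AB0)//.
rewrite ge0_integralZl//; last 3 first.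
- apply: (measurableT_comp (measurable_poweR q)).
  apply: (measurable_fun_fubini_tonelli_F (m2 := m2) (fun z => (K' z * g' z.2)%:E)).
    apply/measurable_EFinP; apply: measurable_funM => //.
    exact: (measurableT_comp mg' measurable_snd).
  by move=> z; rewrite lee_fin mulr_ge0.
- by move=> x _; rewrite poweR_ge0.
- by rewrite poweR_ge0.
apply: (@le_trans _ _ (((A * B)%:E `^ q) `^ q^-1)).
  apply: gt0_ler_poweR; rewrite ?in_itv/= ?leey ?andbT ?poweR_ge0//.
  - by rewrite invr_ge0 ltW.
  - apply: mule_ge0; first by rewrite lee_fin powR_ge0.
    by apply: integral_ge0 => x _; exact: poweR_ge0.
  - by rewrite lee_fin powR_ge0.
  - rewrite -[leRHS]mule1; apply: lee_wpmul2l => //; by rewrite lee_fin powR_ge0.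
by rewrite !poweR_EFin -powRrM mulfV ?gt_eqF// powRr1// ltW.
Qed.

End kernel_young.

(** * Young's inequality for convolutions *)

Section convolution.
Context {R : realType} {n : nat}.
Local Notation V := 'rV[R]_n.+1.
Local Notation leb := (@lebesgue_rV R n).
Implicit Types (f g J : V -> R) (p q r : \bar R).

(** It dominates the convolution of f and g, and its finiteness at x is the
integrability of y |-> f(x - y) g(y). *)
Definition abs_conv f g (x : V) : \bar R :=
  \int[leb]_y `|(f (x - y)%R * g y)%:E|.

Lemma measurable_conv_integrand f g (x : V) :
  measurable_fun setT f -> measurable_fun setT g ->
  measurable_fun setT (fun y : V => (f (x - y)%R * g y)%:E).
Proof.
move=> mf mg; apply/measurable_EFinP; apply: measurable_funM; last exact: mg.
exact: (measurableT_comp mf (measurable_reflection x)).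
Qed.

Lemma ae_conv_integrand f J g (x : V) : {ae leb, forall y, f y = J y} ->
  {ae leb, forall y, (f (x - y)%R * g y)%:E = (J (x - y)%R * g y)%:E}.
Proof. by move=> /(ae_reflection x); apply: filterS => y ->. Qed.

Lemma measurable_conv_kernel J g :
  measurable_fun setT (fun z : V * V => J (z.1 - z.2)%R) ->
  measurable_fun setT g ->
  measurable_fun setT (fun z : V * V => (J (z.1 - z.2)%R * g z.2)%:E).
Proof.
move=> mJ mg; apply/measurable_EFinP; apply: measurable_funM; first exact: mJ.
exact: (measurableT_comp mg measurable_snd).
Qed.

Lemma ae_eq_abs_conv f J g : measurable_fun setT f -> measurable_fun setT J ->
  measurable_fun setT g -> {ae leb, forall x, f x = J x} ->
  abs_conv f g = abs_conv J g.
Proof.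
move=> mf mJ mg fJ; apply/funext => x.
have mi h (mh : measurable_fun setT h) :=
  measurableT_comp (@abse_measurable R setT) (measurable_conv_integrand x mh mg).
have := ae_conv_integrand g x fJ; rewrite /abs_conv => fJg.
apply: ge0_ae_eq_integral.
- exact: measurableT.
- exact: mi mf.
- exact: mi mJ.
- by move=> y _; exact: abse_ge0.
- by move=> y _; exact: abse_ge0.
- by apply: filterS fJg => y -> _.
Qed.

Lemma measurable_abs_conv_kernel J g :
  measurable_fun setT (fun z : V * V => J (z.1 - z.2)%R) ->
  measurable_fun setT g -> measurable_fun setT (abs_conv J g).
Proof.
move=> dJ mg.
have mk := measurableT_comp (@abse_measurable R setT) (measurable_conv_kernel dJ mg).
apply: (measurable_fun_fubini_tonelli_F (m2 := leb) _ mk).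
by move=> z; exact: abse_ge0.
Qed.

Lemma measurable_abs_conv f g : measurable_fun setT f -> measurable_fun setT g ->
  measurable_fun setT (abs_conv f g).
Proof.
move=> mf mg; have [J [mJ fJ dJ]] := diff_measurable_version mf.
by rewrite (ae_eq_abs_conv mf mJ mg fJ); exact: measurable_abs_conv_kernel.
Qed.

(** By invariance, every section of (x, y) |-> J(x - y) has the same L^r norm
as f. *)
Lemma young f g p q r : 0 < leb setT ->
  measurable_fun setT f -> measurable_fun setT g ->
  1 <= p -> 1 <= q -> 1 <= r -> q^-1 = p^-1 + r^-1 - 1 ->
  'N[leb]_r[EFin \o f] < +oo -> 'N[leb]_p[EFin \o g] < +oo ->
  'N[leb]_q[abs_conv f g] <= 'N[leb]_r[EFin \o f] * 'N[leb]_p[EFin \o g].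
Proof.
move=> leb0 mf mg p1 q1 r1 pqr fr gp.
have [J [mJ fJ dJ]] := diff_measurable_version mf.
have mEf : measurable_fun setT (EFin \o f) by exact/measurable_EFinP.
have mEJ : measurable_fun setT (EFin \o J) by exact/measurable_EFinP.
have NfJ : 'N[leb]_r[EFin \o f] = 'N[leb]_r[EFin \o J].
  by apply: ae_eq_Lnorm => //; apply: filterS fJ => x /= ->.
have Ar : 'N[leb]_r[EFin \o f] \is a fin_num.
  by rewrite ge0_fin_numE ?Lnorm_ge0.
rewrite (ae_eq_abs_conv mf mJ mg fJ) -[X in _ <= X * _](fineK Ar).
apply: (@kernel_young _ _ _ _ _ leb leb (fun z : V * V => J (z.1 - z.2)%R) g
  p q r (fine 'N[leb]_r[EFin \o f])).
- exact: leb0.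
- exact: leb0.
- exact: dJ.
- exact: mg.
- exact: p1.
- exact: q1.
- exact: r1.
- exact: pqr.
- by apply: fine_ge0; exact: Lnorm_ge0.
- by move=> x; rewrite fineK//= NfJ (Lnorm_reflection x r1 mJ).
- by move=> y; rewrite fineK//= NfJ (Lnorm_translation (- y)%R r1 mJ).
- exact: gp.
Qed.

End convolution.

(** * The operator between Lebesgue spaces *)

Section integral_lemmas.
Context {R : realType} {d1 d2} {T1 : measurableType d1} {T2 : measurableType d2}.

(** The integral is the difference of those of the positive and negative parts,
which Tonelli's theorem makes measurable; this also holds where both are
infinite, with the convention of the extended reals for the difference. *)
Lemma measurable_integral_section (m2 : {sigma_finite_measure set T2 -> \bar R}%R)
    (k : T1 * T2 -> \bar R) : measurable_fun setT k ->
  measurable_fun setT (fun x => \int[m2]_y k (x, y)).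
Proof.
move=> mk.
rewrite (_ : (fun _ => _) = (fun x => \int[m2]_y k^\+ (x, y)) \-
                            (fun x => \int[m2]_y k^\- (x, y))).
  apply: emeasurable_funB.
    by apply: (measurable_fun_fubini_tonelli_F (m2 := m2) k^\+);
      [exact: measurable_funepos|exact: funepos_ge0].
  by apply: (measurable_fun_fubini_tonelli_F (m2 := m2) k^\-);
    [exact: measurable_funeneg|exact: funeneg_ge0].
apply/funext => x; rewrite integralE/=.
congr (_ - _); apply: eq_integral => y _; first by rewrite !funeposE.
by rewrite !funenegE.
Qed.

Lemma le_fine_integral (mu : {measure set T1 -> \bar R}%R) (h : T1 -> \bar R) :
  measurable_fun setT h ->
  `|(fine (\int[mu]_x h x))%:E| <= \int[mu]_x `|h x|.
Proof.
move=> mh; apply: le_trans (le_abse_integral mu measurableT mh).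
by case: (integral _ _ _) => //=; rewrite normr0 leey.
Qed.

Lemma Lnorm_lty_ae_lty (mu : {measure set T1 -> \bar R}%R) (h : T1 -> \bar R)
    (q : \bar R) : 0 < mu setT -> 1 <= q -> measurable_fun setT h ->
  'N[mu]_q[h] < +oo -> {ae mu, forall x, `|h x| < +oo}.
Proof.
move=> mu0 q1 mh; case: q q1 => [q|_|//]; last first.
  rewrite LnormyE// => hy; apply: filterS (ess_sup_ge mu (abse \o h)) => x.
  by move=> /le_lt_trans; exact.
rewrite lee_fin => q1; have q0 : (0 < q)%R by rewrite (lt_le_trans ltr01).
rewrite unlock => /lty_poweRy; rewrite invr_eq0 gt_eqF// => /(_ isT) hq.
have mq : measurable_fun setT (fun x => `|h x| `^ q).
  by apply: (measurableT_comp (measurable_poweR q)); exact: measurableT_comp.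
have : mu.-integrable setT (fun x => `|h x| `^ q).
  apply/integrableP; split; first exact: mq.
  by under eq_integral do rewrite gee0_abs ?poweR_ge0//.
move=> /(integrable_ae measurableT); apply: filterS => x /(_ I).
rewrite ge0_fin_numE ?poweR_ge0// => /lty_poweRy; apply.
by rewrite gt_eqF.
Qed.

End integral_lemmas.

Section kernel_operator_theory.
Context {R : realType} {n : nat}.
Local Notation V := 'rV[R]_n.+1.
Local Notation leb := (@lebesgue_rV R n).
Implicit Types (f g J u v : V -> R) (p q r : \bar R).

(** The value is kept in the extended reals, where it can be compared with
[abs_conv]; [kernel_operatorE] recovers the operator with [fine]. *)
Definition conv f g (x : V) : \bar R := \int[leb]_y (f (x - y)%R * g y)%:E.

Lemma ae_eq_conv f J g h : measurable_fun setT f -> measurable_fun setT J ->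
  measurable_fun setT g -> measurable_fun setT h ->
  {ae leb, forall x, f x = J x} -> {ae leb, forall x, g x = h x} ->
  conv f g = conv J h.
Proof.
move=> mf mJ mg mh fJ gh; apply/funext => x.
have fJx := ae_reflection x fJ.
rewrite /conv; apply: ae_eq_integral.
- exact: measurableT.
- exact: measurable_conv_integrand.
- exact: measurable_conv_integrand.
- by apply: filterS2 fJx gh => y -> -> _.
Qed.

Lemma measurable_conv f g : measurable_fun setT f -> measurable_fun setT g ->
  measurable_fun setT (fun x => fine (conv f g x)).
Proof.
move=> mf mg; have [J [mJ fJ dJ]] := diff_measurable_version mf.
rewrite (ae_eq_conv mf mJ mg mg fJ (aeW _ (fun=> erefl))).
have mc : measurable_fun setT (conv J g).
  exact: (measurable_integral_section leb (measurable_conv_kernel dJ mg)).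
exact: (measurableT_comp _ mc).
Qed.

Section on_Omega.
Context (Omega : set V) (mOmega : measurable Omega).

Lemma kernel_operatorE f u :
  kernel_operator Omega f u = fun x => fine (conv f (u \_ Omega) x).
Proof.
apply/funext => x; rewrite /kernel_operator /Rintegral integral_mkcond.
congr (fine _); apply: eq_integral => y _; rewrite !patchE.
by case: ifPn => // _; rewrite mulr0.
Qed.

Lemma LpP p u : Lp p Omega u <->
  measurable_fun setT (u \_ Omega) /\ 'N[leb]_p[EFin \o (u \_ Omega)] < +oo.
Proof.
rewrite /Lp /=; split.
  by rewrite !inE => /andP[]; rewrite !inE.
by move=> [mu Nu]; rewrite inE; apply/andP; split; rewrite inE.
Qed.

Lemma le_fine_conv f g x : measurable_fun setT f -> measurable_fun setT g ->
  `|(fine (conv f g x))%:E| <= abs_conv f g x.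
Proof.
by move=> mf mg; apply: le_fine_integral; exact: measurable_conv_integrand.
Qed.

Lemma abs_conv_ge0 f g x : 0 <= abs_conv f g x.
Proof. by apply: integral_ge0 => y _; exact: abse_ge0. Qed.

Context (p q r : \bar R) (p1 : 1 <= p) (q1 : 1 <= q) (r1 : 1 <= r).
Hypothesis leb0 : 0 < leb setT.
Hypothesis pqr : q^-1 = p^-1 + r^-1 - 1.
Context (f : V -> R) (mf : measurable_fun setT f)
        (fr : 'N[leb]_r[EFin \o f] < +oo).

Lemma abs_conv_Lp_lty u : Lp p Omega u ->
  'N[leb]_q[abs_conv f (u \_ Omega)] < +oo.
Proof.
move=> /LpP[mu up].
apply: (le_lt_trans (young leb0 mf mu p1 q1 r1 pqr fr up)).
by rewrite lte_mul_pinfty ?Lnorm_ge0// ge0_fin_numE ?Lnorm_ge0.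
Qed.

Lemma kernel_operator_measurable u : Lp p Omega u ->
  measurable_fun setT (kernel_operator Omega f u).
Proof. by move=> /LpP[mu up]; rewrite kernel_operatorE; exact: measurable_conv. Qed.

Lemma kernel_operator_norm_le u : Lp p Omega u ->
  fun_norm (Lp q Omega) (kernel_operator Omega f u) <=
    'N[leb]_r[EFin \o f] * fun_norm (Lp p Omega) u.
Proof.
move=> Lu; have [mu up] := (LpP p u).1 Lu.
apply: le_trans (young leb0 mf mu p1 q1 r1 pqr fr up).
apply: ge0_le_Lnorm; [exact: q1|..].
- apply/measurable_EFinP/(measurable_restrictT _ mOmega)/measurable_funTS.
  exact: kernel_operator_measurable.
- exact: measurable_abs_conv.
- move=> x; rewrite /= patchE; case: ifPn => _; last by rewrite normr0 abse_ge0.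
  rewrite kernel_operatorE [leRHS]gee0_abs ?abs_conv_ge0//.
  exact: le_fine_conv.
Qed.

Lemma kernel_operator_Lp u : Lp p Omega u -> Lp q Omega (kernel_operator Omega f u).
Proof.
move=> Lu; have [mu up] := (LpP p u).1 Lu; apply/LpP; split.
  apply/(measurable_restrictT _ mOmega)/measurable_funTS.
  exact: kernel_operator_measurable.
apply: (le_lt_trans (kernel_operator_norm_le Lu)).
by rewrite lte_mul_pinfty ?Lnorm_ge0// ge0_fin_numE ?Lnorm_ge0.
Qed.

(** [abs_conv f u] has a finite L^q norm, so it is finite almost everywhere. *)
Lemma conv_integrable u : Lp p Omega u ->
  {ae leb, forall x, leb.-integrable setT (fun y => (f (x - y) * (u \_ Omega) y)%:E)}.
Proof.
move=> Lu; have [mu up] := (LpP p u).1 Lu.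
have := Lnorm_lty_ae_lty leb0 q1 (measurable_abs_conv mf mu) (abs_conv_Lp_lty Lu).
apply: filterS => x; rewrite gee0_abs ?abs_conv_ge0// => xoo.
by apply/integrableP; split; [exact: measurable_conv_integrand|exact: xoo].
Qed.

Lemma kernel_operator_definedP : kernel_operator_defined Omega f (Lp p Omega).
Proof.
move=> u Lu; apply: filterS (conv_integrable Lu) => x ix _.
apply/(integrable_mkcond _ mOmega); move: ix.
rewrite (_ : (fun _ => _) = (fun y => (f (x - y) * u y)%:E) \_ Omega)//.
by apply/funext => y; rewrite !patchE; case: ifPn => // _; rewrite mulr0.
Qed.

Lemma kernel_operator_ae u v : Lp p Omega u -> Lp p Omega v ->
  u = v %[ae leb in Omega] -> kernel_operator Omega f u = kernel_operator Omega f v.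
Proof.
move=> /LpP[mu _] /LpP[mv _] uv; rewrite !kernel_operatorE.
rewrite (ae_eq_conv mf mf mu mv (aeW _ (fun=> erefl)))//.
apply: filterS uv => x uv; rewrite !patchE; case: ifPn => //.
by rewrite inE => /uv.
Qed.

Lemma kernel_operator_linear (a : R) u v : Lp p Omega u -> Lp p Omega v ->
  kernel_operator Omega f (a \*: u \+ v)%R =
    (a \*: kernel_operator Omega f u \+ kernel_operator Omega f v)%R
      %[ae leb in Omega].
Proof.
move=> Lu Lv; apply: filterS2 (conv_integrable Lu) (conv_integrable Lv) => x iu iv _.
rewrite !kernel_operatorE /=.
rewrite (_ : conv f _ x = \int[leb]_y (a * (f (x - y) * (u \_ Omega) y) +
     f (x - y) * (v \_ Omega) y)%:E); last first.
  apply: eq_integral => y _; congr EFin; rewrite !patchE.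
  case: ifPn => _; last by rewrite !mulr0 addr0.
  by rewrite (_ : (a \*: u \+ v)%R y = (a * u y + v y)%R)//; ring.
have ia : leb.-integrable setT (fun y => (a * (f (x - y) * (u \_ Omega) y))%:E).
  by have := integrableZl measurableT a iu.
have := RintegralD measurableT ia iv; rewrite /Rintegral /= => ->.
have := RintegralZl a measurableT iu; rewrite /Rintegral /= => ->.
by [].
Qed.

End on_Omega.
End kernel_operator_theory.

(** * Weak derivatives *)

Section kernel_fubini.
Context {R : realType} {d1 d2} {T1 : measurableType d1} {T2 : measurableType d2}.
Context (m1 : {sigma_finite_measure set T1 -> \bar R}%R)
        (m2 : {sigma_finite_measure set T2 -> \bar R}%R).

(** When the positive and negative parts both have infinite integrals, the two
sides are 0. *)
Lemma fine_integralN (f : T1 -> R) :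
  fine (\int[m1]_x (- f x)%:E) = (- fine (\int[m1]_x (f x)%:E))%R.
Proof.
rewrite integralE [in RHS]integralE.
rewrite (_ : (fun x => (- f x)%:E)^\+ = (EFin \o f)^\-)%E; last first.
  by rewrite -funeposN.
rewrite (_ : (fun x => (- f x)%:E)^\- = (EFin \o f)^\+)%E; last first.
  by rewrite -funenegN.
set a := integral _ _ (EFin \o f)^\-; set b := integral _ _ (EFin \o f)^\+.
by case: a => [a||]; case: b => [b||] //=; rewrite ?oppr0// opprB.
Qed.

(** Fubini's theorem for K(x, y) g(y) psi(x), which is integrable because psi is
bounded and vanishes outside B.  The finiteness of the integrals over B allows
pulling psi(x) and g(y) out of the inner integrals. *)
Lemma kernel_fubini (K : T1 * T2 -> R) (g : T2 -> R) (psi : T1 -> R)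
    (M : R) (B : set T1) :
  measurable_fun setT K -> measurable_fun setT g -> measurable_fun setT psi ->
  measurable B -> (0 <= M)%R -> (forall x, `|psi x| <= M)%R -> (forall x, ~ B x -> psi x = 0%R) ->
  \int[m1]_(x in B) \int[m2]_y `|(K (x, y) * g y)%:E| < +oo ->
  (forall y, \int[m1]_(x in B) `|(K (x, y))%:E| < +oo) ->
  \int[m1]_x (fine (\int[m2]_y (K (x, y) * g y)%:E) * psi x)%:E =
  \int[m2]_y (g y * fine (\int[m1]_x (K (x, y) * psi x)%:E))%:E.
Proof.
move=> mK mg mpsi mB M0 psiM psi0 KgB KB.
have mg2 : measurable_fun setT (fun z : T1 * T2 => g z.2).
  exact: (measurableT_comp mg measurable_snd).
have mpsi1 : measurable_fun setT (fun z : T1 * T2 => psi z.1).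
  exact: (measurableT_comp mpsi measurable_fst).
pose F z := (K z * g z.2 * psi z.1)%:E.
have mKg : measurable_fun setT (fun z => (K z * g z.2)%:E).
  by apply/measurable_EFinP; exact: measurable_funM.
have mF : measurable_fun setT F.
  apply/measurable_EFinP; apply: measurable_funM => //; exact: measurable_funM.
have mH : measurable_fun setT (fun x => \int[m2]_y `|(K (x, y) * g y)%:E|).
  apply: (measurable_integral_section m2 (k := fun z => `|(K z * g z.2)%:E|)).
  exact: measurableT_comp.
have H0 x : 0 <= \int[m2]_y `|(K (x, y) * g y)%:E| by exact: integral_ge0.
have mKgx x : measurable_fun setT (fun y => (K (x, y) * g y)%:E).
  apply/measurable_EFinP; apply: measurable_funM => //.
  exact: measurable_kernel_section1.
have intF : (m1 \x m2)%E.-integrable setT F.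
  apply/(integrable12ltyP _ _ mF).
  apply: (@le_lt_trans _ _ (M%:E * \int[m1]_(x in B) \int[m2]_y `|(K (x, y) * g y)%:E|)).
    rewrite -ge0_integralZl//; last exact: measurable_funTS.
    rewrite [leRHS]integral_mkcond; apply: ge0_le_integral => //.
    - by move=> x _; exact: integral_ge0.
    - apply: (measurable_integral_section m2 (k := fun z => `|F z|)).
      exact: measurableT_comp.
    - apply/(measurable_restrictT _ mB)/measurable_funTS.
      by apply: emeasurable_funM => //; exact: measurable_cst.
    move=> x _; rewrite patchE; case: ifPn => [_|xB]; last first.
      have px : psi x = 0%R by apply: psi0 => Bx; rewrite mem_set in xB.
      by under eq_integral do rewrite /F/= px mulr0 normr0; rewrite integral0.
    rewrite -ge0_integralZl//; last exact: measurableT_comp.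
    apply: ge0_le_integral => //.
    - apply: measurableT_comp => //.
      exact: (measurableT_comp mF (pair1_measurable x)).
    - by apply: emeasurable_funM => //; exact: measurableT_comp.
    - move=> y _; rewrite /F/= -EFinM lee_fin [leRHS]mulrC normrM.
      by rewrite ler_wpM2l.
  by rewrite lte_mul_pinfty.
have := Fubini intF.
rewrite (_ : \int[m1]_x \int[m2]_y F (x, y) =
    \int[m1]_x (fine (\int[m2]_y (K (x, y) * g y)%:E) * psi x)%:E); last first.
  apply: ae_eq_integral => //.
  - exact: (measurable_integral_section m2 (k := F)).
  - apply/measurable_EFinP; apply: measurable_funM => //.
    apply: (measurableT_comp (f := fine)) => //.
    exact: (measurable_integral_section m2 (k := fun z => (K z * g z.2)%:E)).
  have : m1.-integrable B (fun x => \int[m2]_y `|(K (x, y) * g y)%:E|).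
    apply/integrableP; split; first exact: measurable_funTS.
    by under eq_integral do rewrite gee0_abs//.
  move=> /(integrable_ae mB); apply: filterS => x fx _.
  have [Bx|Bx] := pselect (B x); last first.
    rewrite psi0// mulr0.
    by under eq_integral do rewrite /F/= psi0// mulr0; rewrite integral0.
  have ix : m2.-integrable setT (fun y => (K (x, y) * g y)%:E).
    apply/integrableP; split => //.
    by move: (fx Bx); rewrite ge0_fin_numE.
  rewrite EFinM fineK ?integrable_fin_num// -integralZr//.
rewrite (_ : \int[m2]_y \int[m1]_x F (x, y) =
    \int[m2]_y (g y * fine (\int[m1]_x (K (x, y) * psi x)%:E))%:E)//.
apply: eq_integral => y _.
have iy : m1.-integrable setT (fun x => (K (x, y) * psi x)%:E).
  apply/integrableP; split.
    apply/measurable_EFinP; apply: measurable_funM => //.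
    exact: measurable_kernel_section2.
  apply: (@le_lt_trans _ _ (M%:E * \int[m1]_(x in B) `|(K (x, y))%:E|)); last first.
    by rewrite lte_mul_pinfty// KB.
  rewrite -ge0_integralZl//; last first.
    apply: measurable_funTS; apply: measurableT_comp => //; apply/measurable_EFinP.
    exact: measurable_kernel_section2.
  rewrite [leRHS]integral_mkcond; apply: ge0_le_integral => //.
  - apply: measurableT_comp => //; apply/measurable_EFinP.
    by apply: measurable_funM => //; exact: measurable_kernel_section2.
  - apply/(measurable_restrictT _ mB)/measurable_funTS; apply: emeasurable_funM => //.
    apply: measurableT_comp => //; apply/measurable_EFinP.
    exact: measurable_kernel_section2.
  move=> x _; rewrite patchE; case: ifPn => [_|xB].
    by rewrite -EFinM/= lee_fin normrM mulrC ler_wpM2r.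
  have px : psi x = 0%R by apply: psi0 => Bx; rewrite mem_set in xB.
  by rewrite px mulr0 abse0.
rewrite EFinM fineK ?integrable_fin_num// -integralZl//.
by apply: eq_integral => x _; rewrite /F/= -EFinM; congr EFin; ring.
Qed.

End kernel_fubini.

Section test_functions.
Context {R : realType} {n : nat}.
Local Notation V := 'rV[R]_n.+1.
Local Notation leb := (@lebesgue_rV R n).
Implicit Types (phi psi : V -> R) (Omega : set V).

Lemma shifted_difference phi (y x v : V) :
  (fun h : R => h^-1 *: (((fun z => phi (z + y)) \o shift x) (h *: v) - phi (x + y)))%R =
  (fun h : R => h^-1 *: ((phi \o shift (x + y)) (h *: v) - phi (x + y)))%R.
Proof. by apply/funext => h /=; rewrite addrA. Qed.

Lemma partial_shift i phi (y : V) :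
  partial i (fun x => phi (x + y)%R) = (fun x => partial i phi (x + y)%R).
Proof.
by apply/funext => x; rewrite /partial /derive shifted_difference.
Qed.

Lemma foldr_partial_shift phi (y : V) (s : seq 'I_n.+1) :
  foldr partial (fun x => phi (x + y)%R) s =
  (fun x => foldr partial phi s (x + y)%R).
Proof. by elim: s => //= i s ->; exact: partial_shift. Qed.

Lemma continuous_shift (y : V) : continuous (fun x : V => x + y)%R.
Proof.
move=> x; apply: (@cvgD R V V (nbhs x) _ id (cst y) x y).
  exact: cvg_id.
exact: cvg_cst.
Qed.

Lemma Cinfty_shift phi (y : V) : Cinfty phi -> Cinfty (fun x => phi (x + y)%R).
Proof.
move=> cphi s; rewrite foldr_partial_shift; have [cs ds] := cphi s; split.
  move=> x; apply: (@continuous_comp _ _ _ (fun x : V => x + y)%R _ x).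
    exact: continuous_shift.
  exact: cs.
by move=> i x; rewrite /derivable shifted_difference; exact: ds.
Qed.

(** The support of the translate is contained in a translate of the support,
which is compact. The translate may well leave Omega, hence the conclusion on
the whole space. *)
Lemma test_function_shift Omega phi (y : V) :
  test_function Omega phi -> test_function setT (fun x => phi (x + y)%R).
Proof.
move=> [cphi kphi _]; split; [exact: Cinfty_shift| |by []].
set S := closure [set x | phi x != 0%R] in kphi.
have kS : compact ((fun x => x - y)%R @` S).
  apply: continuous_compact => //.
  by apply: continuous_subspaceT => x; exact: continuous_shift.
apply: (subclosed_compact _ kS); first exact: closed_closure.
rewrite [X in _ `<=` X](closure_id _).1; last first.
  by apply: compact_closed => //; exact: norm_hausdorff.
apply: closure_subset => x /= phix; exists (x + y)%R; last by rewrite addrK.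
exact: subset_closure.
Qed.

Lemma test_function_partial0 Omega i phi (x : V) : test_function Omega phi ->
  ~ closure [set x | phi x != 0%R] x -> partial i phi x = 0%R.
Proof.
move=> _ Sx; rewrite /partial -(derive_cst (0 : R)%R x (delta_mx ord0 i)).
apply: near_eq_derive.
have : nbhs x (~` closure [set x | phi x != 0%R]).
  by apply: open_nbhs_nbhs; split => //; apply: closed_openC; exact: closed_closure.
apply: filterS => z Sz; apply/eqP; apply: contrapT => /negP phiz.
by apply: Sz; apply: subset_closure.
Qed.

Lemma compact_support_bounds psi (S : set V) : continuous psi -> compact S ->
  (forall x, ~ S x -> psi x = 0%R) -> exists M k, [/\ (0 <= M)%R,
    (forall x, `|psi x| <= M)%R & forall x, ~ cube k x -> psi x = 0%R].
Proof.
move=> cpsi kS psi0.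
have /compact_bounded[M1 [_ bM]] : compact (psi @` S).
  by apply: continuous_compact => //; exact: continuous_subspaceT.
have /compact_bounded[M2 [_ bS]] := kS.
exists (`|M1| + 1)%R, (Num.truncn (`|M2| + 1)%R).+1; split.
- by rewrite addr_ge0.
- move=> x; have [Sx|Sx] := pselect (S x); last by rewrite psi0// normr0 addr_ge0.
  apply: bM; last by exists x.
  by rewrite (le_lt_trans (ler_norm _))// ltrDl.
- move=> x xk; apply: psi0 => Sx; apply: xk; apply: cubeP.
  apply: le_lt_trans (truncnS_gt _); apply: bS => //.
  by rewrite (le_lt_trans (ler_norm _))// ltrDl.
Qed.

End test_functions.

Section weak_derivative.
Context {R : realType} {n : nat}.
Local Notation V := 'rV[R]_n.+1.
Local Notation leb := (@lebesgue_rV R n).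
Context (Omega : set V) (mOmega : measurable Omega).
Context (p q r : \bar R) (p1 : 1 <= p) (q1 : 1 <= q) (r1 : 1 <= r).
Hypothesis leb0 : 0 < leb setT.
Hypothesis pqr : q^-1 = p^-1 + r^-1 - 1.

(** [kernel_fubini] for the kernel J(x - y), followed by the change of variable
z = x - y in the inner integral. *)
Lemma kernel_operator_pairing (f u psi : V -> R) (M : R) (k : nat) :
  measurable_fun setT f -> 'N[leb]_r[EFin \o f] < +oo -> Lp p Omega u ->
  measurable_fun setT psi -> (0 <= M)%R -> (forall x, `|psi x| <= M)%R ->
  (forall x, ~ cube k x -> psi x = 0%R) -> (forall x, ~ Omega x -> psi x = 0%R) ->
  (\int[leb]_(x in Omega) (kernel_operator Omega f u x * psi x))%R =
  fine (\int[leb]_y ((u \_ Omega) y * fine (\int[leb]_z (f z * psi (z + y)%R)%:E))%:E).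
Proof.
move=> mf fr Lu mpsi M0 psiM psik psiO.
have [mu up] := (LpP Omega p u).1 Lu.
have [J [mJ fJ dJ]] := diff_measurable_version mf.
have mEf : measurable_fun setT (EFin \o f) by exact/measurable_EFinP.
have mEJ : measurable_fun setT (EFin \o J) by exact/measurable_EFinP.
have Jr : 'N[leb]_r[EFin \o J] < +oo.
  rewrite -(_ : 'N[leb]_r[EFin \o f] = 'N[leb]_r[EFin \o J])//.
  by apply: (ae_eq_Lnorm r1 mEf mEJ); apply: filterS fJ => x /= ->.
have mk : measurable (@cube R n k) by exact: measurable_box.
have koo : leb (cube k) < +oo by exact: lebesgue_rV_box_lty.
rewrite kernel_operatorE (ae_eq_conv mf mJ mu mu fJ (aeW _ (fun=> erefl))).
rewrite /Rintegral integral_mkcond; congr fine.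
transitivity (\int[leb]_x (fine (conv J (u \_ Omega) x) * psi x)%:E).
  apply: eq_integral => x _; rewrite patchE; case: ifPn => // xO.
  by rewrite psiO ?mulr0// => Ox; rewrite mem_set in xO.
rewrite (kernel_fubini (m1 := leb) (m2 := leb)
  (K := fun z : V * V => J (z.1 - z.2)%R) dJ mu mpsi mk M0 psiM psik).
- apply: eq_integral => y _; congr ((_ * fine _)%R%:E).
  have mJpsi : measurable_fun setT (fun x : V => (J (x - y) * psi x)%:E).
    apply/measurable_EFinP; apply: measurable_funM; last exact: mpsi.
    exact: (measurableT_comp mJ (measurable_translation (- y)%R)).
  rewrite -[LHS](integral_translation y mJpsi).
  apply: ae_eq_integral.
  + exact: measurableT.
  + apply/measurable_EFinP; apply: measurable_funM.
      apply: (measurableT_comp mJ).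
      exact: (measurableT_comp (measurable_translation (- y)%R) (measurable_translation y)).
    exact: (measurableT_comp mpsi (measurable_translation y)).
  + apply/measurable_EFinP; apply: measurable_funM; first exact: mf.
    exact: (measurableT_comp mpsi (measurable_translation y)).
  + by apply: filterS fJ => z -> _ /=; rewrite addrK.
- have mH := measurable_abs_conv mJ mu.
  have := abs_conv_Lp_lty p1 q1 r1 leb0 pqr mJ Jr Lu.
  move=> /(Lnorm_lty_integral_lty leb0 q1 mH mk koo).
  by under eq_integral do rewrite gee0_abs ?abs_conv_ge0//.
- move=> y.
  have mJy : measurable_fun setT (EFin \o (fun x => J (x - y)%R)).
    by apply/measurable_EFinP; exact: (measurableT_comp mJ (measurable_translation (- y)%R)).
  apply: (Lnorm_lty_integral_lty leb0 r1 mJy mk koo).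
  by rewrite (Lnorm_translation (- y)%R r1 mJ).
Qed.

(** For each y, the hypothesis on G is used with the test function
z |-> phi (z + y). *)
Lemma weak_partial_kernel_operator (i : 'I_n.+1) (f G u : V -> R) :
  measurable_fun setT f -> 'N[leb]_r[EFin \o f] < +oo ->
  measurable_fun setT G -> 'N[leb]_r[EFin \o G] < +oo ->
  Lp p Omega u -> weak_partial setT i f G ->
  weak_partial Omega i (kernel_operator Omega f u) (kernel_operator Omega G u).
Proof.
move=> mf fr mG Gr Lu fG phi tphi; have [cphi kphi sphi] := tphi.
have [cont_phi _] := cphi [::]; have [cont_dphi _] := cphi [:: i].
have phi0 x : ~ closure [set x | phi x != 0%R] x -> phi x = 0%R.
  move=> Sx; apply/eqP; apply: contrapT => /negP phix.
  by apply: Sx; exact: subset_closure.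
have dphi0 x := test_function_partial0 i (x := x) tphi.
have [M [k [M0 phiM phik]]] := compact_support_bounds cont_phi kphi phi0.
have [M' [k' [M'0 dphiM dphik]]] := compact_support_bounds cont_dphi kphi dphi0.
rewrite (kernel_operator_pairing mf fr Lu _ M'0 dphiM dphik); last 2 first.
- exact: continuous_measurable_rV.
- by move=> x Ox; apply: dphi0; apply: contra_not Ox; exact: sphi.
rewrite (kernel_operator_pairing mG Gr Lu _ M0 phiM phik); last 2 first.
- exact: continuous_measurable_rV.
- by move=> x Ox; apply: phi0; apply: contra_not Ox; exact: sphi.
rewrite -fine_integralN; congr fine; apply: eq_integral => y _.
rewrite -mulrN; congr ((_ * _)%R%:E).
have := fG _ (test_function_shift y tphi).
by rewrite partial_shift.
Qed.

End weak_derivative.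

(** * Operator bounds *)

Section operator_bounds.
Context {R : realType} {n : nat}.
Local Notation V := 'rV[R]_n.+1.
Local Notation leb := (@lebesgue_rV R n).
Context (Omega : set V) (mOmega : measurable Omega).
Context (p q r : \bar R) (p1 : 1 <= p) (q1 : 1 <= q) (r1 : 1 <= r).
Hypothesis leb0 : 0 < leb setT.
Hypothesis pqr : q^-1 = p^-1 + r^-1 - 1.

Lemma operator_norm_le (X Y : fun_space R n) (K : (V -> R) -> (V -> R)) (C : \bar R) :
  0 <= C -> (forall u, X u -> fun_norm Y (K u) <= C * fun_norm X u) ->
  operator_norm X Y K <= C.
Proof.
move=> C0 KC; apply: ge_ereal_sup => _ [u [Xu u1] <-].
by apply: (le_trans (KC u Xu)); rewrite -[leRHS]mule1 lee_wpmul2l.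
Qed.

Lemma LpTP (f : V -> R) : Lp r setT f <->
  measurable_fun setT f /\ 'N[leb]_r[EFin \o f] < +oo.
Proof. by rewrite -[in X in _ <-> X](patch_setT (fun=> point) f); exact: LpP. Qed.

Lemma fun_norm_LpT (f : V -> R) : fun_norm (Lp r setT) f = 'N[leb]_r[EFin \o f].
Proof. by rewrite /fun_norm/= patch_setT. Qed.

Lemma kernel_operator_Lp_bounded (J0 : V -> R) : Lp r setT J0 ->
  [/\ kernel_operator_defined Omega J0 (Lp p Omega),
      bounded_linear Omega (Lp p Omega) (Lp q Omega) (kernel_operator Omega J0) &
      operator_norm (Lp p Omega) (Lp q Omega) (kernel_operator Omega J0)
        <= fun_norm (Lp r setT) J0].
Proof.
move=> /LpTP[mJ Jr]; rewrite fun_norm_LpT.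
have norm_le u : Lp p Omega u -> _ :=
  kernel_operator_norm_le mOmega p1 q1 r1 leb0 pqr mJ Jr (u := u).
split.
- exact: (kernel_operator_definedP mOmega p1 q1 r1 leb0 pqr mJ Jr).
- split.
  + by move=> u; exact: (kernel_operator_Lp mOmega p1 q1 r1 leb0 pqr mJ Jr).
  + move=> u v Lu Lv uv; rewrite (kernel_operator_ae mJ Lu Lv uv).
    by apply: aeW.
  + by move=> a u v; exact: (kernel_operator_linear p1 q1 r1 leb0 pqr mJ Jr).
  + exists (fine 'N[leb]_r[EFin \o J0]) => u Lu.
    by rewrite fineK ?ge0_fin_numE ?Lnorm_ge0//; exact: norm_le.
- by apply: operator_norm_le => //; exact: Lnorm_ge0.
Qed.

Lemma kernel_operator_W1 (J0 u : V -> R) (G : 'I_n.+1 -> V -> R) :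
  Lp r setT J0 -> weak_gradient r setT J0 G -> Lp p Omega u ->
  weak_gradient q Omega (kernel_operator Omega J0 u)
    (fun i => kernel_operator Omega (G i) u).
Proof.
move=> /LpTP[mJ Jr] gG Lu i; have [/LpTP[mG Gr] wG] := gG i; split.
  exact: (kernel_operator_Lp mOmega p1 q1 r1 leb0 pqr mG Gr).
exact: (weak_partial_kernel_operator p1 q1 r1 leb0 pqr mJ Jr mG Gr Lu wG).
Qed.

(** The gradient of K u provided by G is a competitor in the infimum defining
the left-hand side, and each term of its norm is bounded by Young's
inequality. *)
Lemma kernel_operator_W1_norm_le (J0 u : V -> R) :
  W1 r setT J0 -> Lp p Omega u -> forall G, weak_gradient r setT J0 G ->
  fun_norm (W1 q Omega) (kernel_operator Omega J0 u) <=
    (fun_norm (Lp r setT) J0 + \sum_i fun_norm (Lp r setT) (G i)) *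
    fun_norm (Lp p Omega) u.
Proof.
move=> [LJ _] Lu G gG; have [mJ Jr] := (LpTP J0).1 LJ.
apply: (@le_trans _ _ (fun_norm (Lp q Omega) (kernel_operator Omega J0 u) +
    \sum_i fun_norm (Lp q Omega) (kernel_operator Omega (G i) u))).
  by apply: ereal_inf_lbound; exists (fun i => kernel_operator Omega (G i) u) => //;
     exact: kernel_operator_W1.
have N0 (f : V -> R) : 0 <= fun_norm (Lp r setT) f by exact: Lnorm_ge0.
rewrite ge0_muleDl//; last by apply: sume_ge0 => i _; exact: N0.
rewrite ge0_sume_distrl; last by move=> i _; exact: N0.
apply: leeD.
  by rewrite fun_norm_LpT; exact: (kernel_operator_norm_le mOmega p1 q1 r1 leb0 pqr mJ Jr).
apply: lee_sum => i _; have [/LpTP[mG Gr] wG] := gG i.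
by rewrite fun_norm_LpT; exact: (kernel_operator_norm_le mOmega p1 q1 r1 leb0 pqr mG Gr).
Qed.

Lemma kernel_operator_W1_bounded (J0 : V -> R) : W1 r setT J0 ->
  [/\ kernel_operator_defined Omega J0 (Lp p Omega),
      bounded_linear Omega (Lp p Omega) (W1 q Omega) (kernel_operator Omega J0) &
      operator_norm (Lp p Omega) (W1 q Omega) (kernel_operator Omega J0)
        <= fun_norm (W1 r setT) J0].
Proof.
move=> WJ; have [LJ [G gG]] := WJ.
have [dJ [KLp Kae Klin _] _] := kernel_operator_Lp_bounded LJ.
have N0 (f : V -> R) : 0 <= fun_norm (Lp r setT) f by exact: Lnorm_ge0.
have W0 (H : 'I_n.+1 -> V -> R) : 0 <= fun_norm (Lp r setT) J0 + \sum_i fun_norm (Lp r setT) (H i).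
  have S0 : 0 <= \sum_i fun_norm (Lp r setT) (H i).
    by apply: sume_ge0 => i _; exact: N0.
  exact: adde_ge0 (N0 J0) S0.
split => //.
- split => //.
  + move=> u Lu; split; first exact: KLp.
    by exists (fun i => kernel_operator Omega (G i) u); exact: kernel_operator_W1.
  + exists (fine (fun_norm (Lp r setT) J0 + \sum_i fun_norm (Lp r setT) (G i))) => u Lu.
    rewrite fineK; first exact: kernel_operator_W1_norm_le.
    have Nfin (f : V -> R) : Lp r setT f -> fun_norm (Lp r setT) f \is a fin_num.
      by move=> Lf; rewrite ge0_fin_numE// fun_norm_LpT; have [] := (LpTP f).1 Lf.
    rewrite fin_numD Nfin//=; apply/sum_fin_numP => i _ _.
    by apply: Nfin; have [] := gG i.
- apply: le_ereal_inf_tmp => _ [H gH <-].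
  apply: operator_norm_le => // u Lu; exact: kernel_operator_W1_norm_le.
Qed.

End operator_bounds.

Theorem proposition3p4 (R : realType) (n : nat) (Omega : set 'rV[R]_n.+1)
  (mOmega : measurable Omega) (Omega_infty : lebesgue_rV Omega = +oo)
  (p q r : \bar R) (p1 : 1 <= p) (q1 : 1 <= q) (r1 : 1 <= r)
  (J0 : 'rV[R]_n.+1 -> R) :
  (Lp r setT J0 -> q^-1 = p^-1 + r^-1 - 1 ->
    [/\ kernel_operator_defined Omega J0 (Lp p Omega),
        bounded_linear Omega (Lp p Omega) (Lp q Omega)
          (kernel_operator Omega J0) &
        operator_norm (Lp p Omega) (Lp q Omega) (kernel_operator Omega J0)
          <= fun_norm (Lp r setT) J0]) /\
  (Lp 1 setT J0 ->
    [/\ kernel_operator_defined Omega J0 (Lp p Omega),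
        bounded_linear Omega (Lp p Omega) (Lp p Omega)
          (kernel_operator Omega J0) &
        operator_norm (Lp p Omega) (Lp p Omega) (kernel_operator Omega J0)
          <= fun_norm (Lp 1 setT) J0]) /\
  (open Omega -> W1 r setT J0 -> q^-1 = p^-1 + r^-1 - 1 ->
    [/\ kernel_operator_defined Omega J0 (Lp p Omega),
        bounded_linear Omega (Lp p Omega) (W1 q Omega)
          (kernel_operator Omega J0) &
        operator_norm (Lp p Omega) (W1 q Omega) (kernel_operator Omega J0)
          <= fun_norm (W1 r setT) J0]).
Proof.
have leb0 : 0 < lebesgue_rV [set: 'rV[R]_n.+1].
  apply: (@lt_le_trans _ _ (lebesgue_rV Omega)); first by rewrite Omega_infty.
  by apply: le_lebesgue_outer.
split; [|split].
- by move=> LJ pqr; exact: (kernel_operator_Lp_bounded mOmega p1 q1 r1 leb0 pqr LJ).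
- move=> LJ; apply: (kernel_operator_Lp_bounded mOmega p1 p1 _ leb0 _ LJ) => //.
  case: (p) p1 => [s| |//] s1; last by rewrite invey inve1 add0e subee.
  by rewrite inver gt_eqF ?(lt_le_trans ltr01)// inve1 addeK.
- move=> _ WJ pqr.
  exact: (kernel_operator_W1_bounded mOmega p1 q1 r1 leb0 pqr WJ).
Qed.
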